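(* (In ZF.) The following conditions are equivalent. (KL) Kőnig's Lemma: every infinite locally finite connected graph has a ray. (KL1) Every infinite locally finite connected graph has the distinguishing number. (KL2) Every infinite locally finite connected graph has the distinguishing index. (KL3) Every infinite locally finite connected graph has the chromatic index. (KL4) Every infinite locally finite connected graph has the chromatic number. (KL5) For every almost $\aleph_0$-acceptable family $\mathcal{A}$ the graph $G_{\mathcal{A}}$ has the distinguishing number. (KL6) For every almost $\aleph_0$-acceptable family $\mathcal{A}$ the graph $G_{\mathcal{A}}$ has the distinguishing index. (KL7) For every almost $\aleph_0$-acceptable family $\mathcal{A}$ the graph $G_{\mathcal{A}}$ has the chromatic index. (KL8) For every almost $\aleph_0$-acceptable family $\mathcal{A}$ the graph $H_{\mathcal{A}}$ has the chromatic number.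
   Context: Work in ZF, without the Axiom of Choice. A cardinal number is an initial ordinal, i.e. an ordinal not equinumerous with any smaller ordinal. Graphs are simple and undirected; a graph is locally finite if each vertex has finite degree; a ray is a one-way infinite path. Colourings are not assumed proper unless stated. An automorphism $\varphi$ of $G$ preserves a vertex (edge) colouring if each vertex (edge) is mapped to a vertex (edge) of the same colour; a colouring is distinguishing if the only automorphism of $G$ preserving it is the identity. The distinguishing number (resp. distinguishing index) of $G$ is the least cardinal number of colours in a distinguishing vertex (resp. edge) colouring of $G$ whose colours are ordinals (or elements of a well-ordered set); $G$ ''has the distinguishing number'' (resp. index) if such a colouring with colours from a cardinal number (equivalently, from some well-ordered set) exists. Likewise, $G$ has the chromatic number (resp. chromatic index) if it has a proper vertex (resp. edge) colouring with colours from some cardinal number, and the chromatic number (index) is the least number of colours in such a colouring. A family $\mathcal{A}=\{A_i : i\in\omega\}$ is acceptable if it is a countable family (indexed by $\omega$) of pairwise disjoint non-empty sets. For a cardinal $\kappa$, it is almost $\kappa$-acceptable if it is acceptable and every set in $\mathcal{A}$ has cardinality less than $\kappa$ (so almost $\aleph_0$-acceptable means all $A_i$ are finite). Given an acceptable family $\mathcal{A}=\{A_i:i\in\omega\}$, let $Y=\bigcup\mathcal{A}$, and let $Z=\{z_i:i\in\omega\}$ and $Z'=\{z'_i:i\in\omega\}$ be disjoint sets (each enumerated without repetition), also disjoint from $Y$. The graphs $G_{\mathcal{A}}$ and $H_{\mathcal{A}}$ are defined by $V(G_{\mathcal{A}})=V(H_{\mathcal{A}})=Y\cup Z\cup Z'$,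 $E(G_{\mathcal{A}})=\{z_iz_{i+1}:i\in\omega\}\cup\{z_iz'_i:i\in\omega\}\cup\{a_iz'_i:i\in\omega, a_i\in A_i\}$, $E(H_{\mathcal{A}})=E(G_{\mathcal{A}})\cup\{ab: a\neq b,\ a,b\in A_i,\ i\in\omega\}$. *)

(* Defs.v *)
(** The theorem is a theorem of ZF, without choice.  The logic of Rocq must not
    supply choice principles to the sets under discussion, so "ZF proves P" is
    rendered as "P holds in every structure [(M, ∈)] satisfying the first-order
    axioms of ZF".  The schemas of separation and replacement range over
    first-order formulas only: a version quantifying over all Rocq predicates
    would let a choice axiom of the ambient logic make every model satisfy the
    axiom of choice.

    The mathematical notions below are interpreted inside the model: their
    quantifiers range over [M] (never over subsets of [M] or over functions on
    [M]), and their only atomic formulas are membership and equality. *)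

Set Implicit Arguments.
Unset Strict Implicit.

(** Variables are de Bruijn indices. *)
Inductive formula : Type :=
| fMem (i j : nat)
| fEq (i j : nat)
| fFalse
| fAnd (p q : formula)
| fOr (p q : formula)
| fImp (p q : formula)
| fAll (p : formula)
| fEx (p : formula).

Definition scons (T : Type) (x : T) (e : nat -> T) : nat -> T :=
  fun n => match n with O => x | S m => e m end.

Fixpoint sat (T : Type) (R : T -> T -> Prop) (e : nat -> T) (p : formula) : Prop :=
  match p with
  | fMem i j => R (e i) (e j)
  | fEq i j => e i = e j
  | fFalse => False
  | fAnd p q => sat R e p /\ sat R e q
  | fOr p q => sat R e p \/ sat R e q
  | fImp p q => sat R e p -> sat R e q
  | fAll p => forall x, sat R (scons x e) p
  | fEx p => exists x, sat R (scons x e) p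
  end.

Record ZF : Type := {
  carrier :> Type;
  mem : carrier -> carrier -> Prop;
  zf_extensionality : forall x y : carrier,
    (forall z, mem z x <-> mem z y) -> x = y;
  zf_foundation : forall x : carrier,
    (exists y, mem y x) -> exists y, mem y x /\ ~ (exists z, mem z y /\ mem z x);
  zf_pairing : forall x y : carrier, exists p, forall z, mem z p <-> z = x \/ z = y;
  zf_union : forall x : carrier, exists u,
    forall z, mem z u <-> exists y, mem y x /\ mem z y;
  zf_power : forall x : carrier, exists p,
    forall y, mem y p <-> (forall z, mem z y -> mem z x);
  zf_infinity : exists w : carrier,
    (exists o, mem o w /\ forall z, ~ mem z o) /\
    (forall x, mem x w -> exists y, mem y w /\ forall z, mem z y <-> mem z x \/ z = x);
  (* The environment [e] supplies the parameters. *)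
  zf_separation : forall (p : formula) (e : nat -> carrier) (a : carrier),
    exists b, forall x, mem x b <-> mem x a /\ sat mem (scons x e) p;
  zf_replacement : forall (p : formula) (e : nat -> carrier) (a : carrier),
    (forall x y y', mem x a ->
       sat mem (scons x (scons y e)) p -> sat mem (scons x (scons y' e)) p -> y = y') ->
    exists b, forall y, mem y b <-> exists x, mem x a /\ sat mem (scons x (scons y e)) p
}.

Arguments mem {z} _ _.

Notation "x ∈ y" := (mem x y) (at level 70, no associativity).
Notation "x ∉ y" := (~ mem x y) (at level 70, no associativity).

Definition is_empty (M : ZF) (x : M) : Prop := forall z, z ∉ x.

Definition subset (M : ZF) (x y : M) : Prop := forall z, z ∈ x -> z ∈ y.

Definition is_upair (M : ZF) (p x y : M) : Prop := forall z, z ∈ p <-> z = x \/ z = y.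

(** [p = (x, y)], the Kuratowski pair *)
Definition is_pair (M : ZF) (p x y : M) : Prop :=
  forall z, z ∈ p <-> is_upair z x x \/ is_upair z x y.

Definition is_succ (M : ZF) (y x : M) : Prop := forall z, z ∈ y <-> z ∈ x \/ z = x.

(** [f(x) = y], for a set [f] of ordered pairs *)
Definition app (M : ZF) (f x y : M) : Prop := exists p, is_pair p x y /\ p ∈ f.

Definition is_fun (M : ZF) (f A B : M) : Prop :=
  (forall p, p ∈ f -> exists x y, x ∈ A /\ y ∈ B /\ is_pair p x y) /\
  (forall x, x ∈ A -> exists y, app f x y) /\
  (forall x y y', app f x y -> app f x y' -> y = y').

Definition is_injection (M : ZF) (f A B : M) : Prop :=
  is_fun f A B /\ forall x x' y, app f x y -> app f x' y -> x = x'.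

Definition is_bijection (M : ZF) (f A B : M) : Prop :=
  is_injection f A B /\ forall y, y ∈ B -> exists x, app f x y.

Definition equinumerous (M : ZF) (x y : M) : Prop := exists f, is_bijection f x y.

Definition is_ordinal (M : ZF) (a : M) : Prop :=
  (forall x, x ∈ a -> subset x a) /\
  (forall x, x ∈ a -> x ∉ x) /\
  (forall x y z, x ∈ a -> y ∈ a -> z ∈ a -> x ∈ y -> y ∈ z -> x ∈ z) /\
  (forall x y, x ∈ a -> y ∈ a -> x ∈ y \/ x = y \/ y ∈ x) /\
  (forall s, subset s a -> ~ is_empty s ->
     exists m, m ∈ s /\ forall x, x ∈ s -> m = x \/ m ∈ x).

Definition is_cardinal (M : ZF) (k : M) : Prop :=
  is_ordinal k /\ forall b, b ∈ k -> ~ equinumerous k b.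

Definition is_inductive (M : ZF) (w : M) : Prop :=
  (exists o, is_empty o /\ o ∈ w) /\
  (forall x y, x ∈ w -> is_succ y x -> y ∈ w).

Definition is_omega (M : ZF) (w : M) : Prop :=
  is_inductive w /\ forall v, is_inductive v -> subset w v.

(** For a cardinal [k]: [x] is equinumerous with an ordinal smaller than [k]. *)
Definition card_lt (M : ZF) (x k : M) : Prop := exists b, b ∈ k /\ equinumerous x b.

Definition is_finite (M : ZF) (x : M) : Prop := exists w, is_omega w /\ card_lt x w.

(** A graph is given by a vertex set [V] and a set [E] of two-element subsets of [V]. *)

Definition is_graph (M : ZF) (V E : M) : Prop :=
  forall e, e ∈ E -> exists x y, x ∈ V /\ y ∈ V /\ x <> y /\ is_upair e x y.

Definition adj (M : ZF) (E x y : M) : Prop := exists e, is_upair e x y /\ e ∈ E.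

Definition locally_finite (M : ZF) (V E : M) : Prop :=
  forall v, v ∈ V -> exists N, (forall u, u ∈ N <-> u ∈ V /\ adj E v u) /\ is_finite N.

(** [p] is a path from [x] to [y]: an enumeration [p(0) = x, ..., p(n) = y] of
    distinct vertices, consecutive ones being adjacent.  Its domain is
    [n + 1 = {0, ..., n}]. *)
Definition is_path (M : ZF) (V E p x y : M) : Prop :=
  exists w n n',
    is_omega w /\ n ∈ w /\ is_succ n' n /\ is_injection p n' V /\
    (exists o, is_empty o /\ app p o x) /\ app p n y /\
    (forall i j u v, i ∈ n -> is_succ j i -> app p i u -> app p j v -> adj E u v).

Definition connected (M : ZF) (V E : M) : Prop :=
  forall x y, x ∈ V -> y ∈ V -> exists p, is_path V E p x y.

Definition is_ray (M : ZF) (V E r : M) : Prop :=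
  exists w, is_omega w /\ is_injection r w V /\
    (forall i j u v, i ∈ w -> is_succ j i -> app r i u -> app r j v -> adj E u v).

Definition has_ray (M : ZF) (V E : M) : Prop := exists r, is_ray V E r.

Definition is_automorphism (M : ZF) (V E g : M) : Prop :=
  is_bijection g V V /\
  forall x y x' y', app g x x' -> app g y y' -> (adj E x y <-> adj E x' y').

Definition is_identity (M : ZF) (g : M) : Prop := forall x y, app g x y -> x = y.

(** Colourings are functions with domain [V] or [E]. *)

Definition preserves_vertex_colouring (M : ZF) (g c : M) : Prop :=
  forall x x' k k', app g x x' -> app c x k -> app c x' k' -> k = k'.

Definition preserves_edge_colouring (M : ZF) (g c : M) : Prop :=
  forall x y x' y' e e' k k',
    app g x x' -> app g y y' -> is_upair e x y -> is_upair e' x' y' ->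
    app c e k -> app c e' k' -> k = k'.

Definition distinguishing_vertex_colouring (M : ZF) (V E c : M) : Prop :=
  forall g, is_automorphism V E g -> preserves_vertex_colouring g c -> is_identity g.

Definition distinguishing_edge_colouring (M : ZF) (V E c : M) : Prop :=
  forall g, is_automorphism V E g -> preserves_edge_colouring g c -> is_identity g.

Definition proper_vertex_colouring (M : ZF) (E c : M) : Prop :=
  forall x y k k', adj E x y -> app c x k -> app c y k' -> k <> k'.

Definition proper_edge_colouring (M : ZF) (c : M) : Prop :=
  forall e e' x k k', e <> e' -> x ∈ e -> x ∈ e' -> app c e k -> app c e' k' -> k <> k'.

Definition has_distinguishing_number (M : ZF) (V E : M) : Prop :=
  exists k c, is_cardinal k /\ is_fun c V k /\ distinguishing_vertex_colouring V E c.

Definition has_distinguishing_index (M : ZF) (V E : M) : Prop :=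
  exists k c, is_cardinal k /\ is_fun c E k /\ distinguishing_edge_colouring V E c.

Definition has_chromatic_number (M : ZF) (V E : M) : Prop :=
  exists k c, is_cardinal k /\ is_fun c V k /\ proper_vertex_colouring E c.

Definition has_chromatic_index (M : ZF) (V E : M) : Prop :=
  exists k c, is_cardinal k /\ is_fun c E k /\ proper_edge_colouring c.

(** A family indexed by ω is a function [A] with domain ω; [app A i a] reads
    [a = A_i].  Disjointness is required for distinct indices. *)
Definition acceptable (M : ZF) (A : M) : Prop :=
  (exists w B, is_omega w /\ is_fun A w B) /\
  (forall i a, app A i a -> ~ is_empty a) /\
  (forall i j a b, i <> j -> app A i a -> app A j b -> ~ exists x, x ∈ a /\ x ∈ b).

Definition almost_acceptable (M : ZF) (k A : M) : Prop :=
  acceptable A /\ forall i a, app A i a -> card_lt a k.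

(** [x ∈ Y], where [Y] is the union of the family [A] *)
Definition in_Y (M : ZF) (A x : M) : Prop := exists i a, app A i a /\ x ∈ a.

(** [x] is a value of [z], an enumeration of [Z] *)
Definition in_Z (M : ZF) (z x : M) : Prop := exists i, app z i x.

(** [z] and [z'] enumerate, without repetition, disjoint sets [Z] and [Z'] that
    are also disjoint from [Y]. *)
Definition admissible_enumerations (M : ZF) (A z z' : M) : Prop :=
  (exists w B, is_omega w /\ is_injection z w B) /\
  (exists w B, is_omega w /\ is_injection z' w B) /\
  (forall x, ~ (in_Z z x /\ in_Z z' x)) /\
  (forall x, ~ (in_Z z x /\ in_Y A x)) /\
  (forall x, ~ (in_Z z' x /\ in_Y A x)).

Definition G_edge (M : ZF) (A z z' e : M) : Prop :=
  (exists i j x y, is_succ j i /\ app z i x /\ app z j y /\ is_upair e x y) \/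
  (exists i x y, app z i x /\ app z' i y /\ is_upair e x y) \/
  (exists i a x y, app A i a /\ x ∈ a /\ app z' i y /\ is_upair e x y).

Definition H_edge (M : ZF) (A z z' e : M) : Prop :=
  G_edge A z z' e \/
  (exists i a x y, app A i a /\ x ∈ a /\ y ∈ a /\ x <> y /\ is_upair e x y).

Definition GH_vertices (M : ZF) (A z z' V : M) : Prop :=
  forall x, x ∈ V <-> in_Y A x \/ in_Z z x \/ in_Z z' x.

Definition is_G (M : ZF) (A z z' V E : M) : Prop :=
  GH_vertices A z z' V /\ forall e, e ∈ E <-> G_edge A z z' e.

Definition is_H (M : ZF) (A z z' V E : M) : Prop :=
  GH_vertices A z z' V /\ forall e, e ∈ E <-> H_edge A z z' e.

Definition every_infinite_locally_finite_connected_graph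
    (M : ZF) (P : M -> M -> Prop) : Prop :=
  forall V E : M, is_graph V E -> ~ is_finite V -> locally_finite V E ->
    connected V E -> P V E.

(** For every almost ℵ₀-acceptable family [A], the graph attached to [A] by
    [is_K] satisfies [P], whatever the choice of [Z] and [Z']. *)
Definition every_almost_aleph0_acceptable_graph
    (M : ZF) (is_K : M -> M -> M -> M -> M -> Prop) (P : M -> M -> Prop) : Prop :=
  forall w A z z' V E : M, is_omega w -> almost_acceptable w A ->
    admissible_enumerations A z z' -> is_K A z z' V E -> P V E.

Definition KL (M : ZF) : Prop :=
  every_infinite_locally_finite_connected_graph (@has_ray M).
Definition KL1 (M : ZF) : Prop :=
  every_infinite_locally_finite_connected_graph (@has_distinguishing_number M).
Definition KL2 (M : ZF) : Prop :=
  every_infinite_locally_finite_connected_graph (@has_distinguishing_index M).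
Definition KL3 (M : ZF) : Prop :=
  every_infinite_locally_finite_connected_graph (@has_chromatic_index M).
Definition KL4 (M : ZF) : Prop :=
  every_infinite_locally_finite_connected_graph (@has_chromatic_number M).
Definition KL5 (M : ZF) : Prop :=
  every_almost_aleph0_acceptable_graph (@is_G M) (@has_distinguishing_number M).
Definition KL6 (M : ZF) : Prop :=
  every_almost_aleph0_acceptable_graph (@is_G M) (@has_distinguishing_index M).
Definition KL7 (M : ZF) : Prop :=
  every_almost_aleph0_acceptable_graph (@is_G M) (@has_chromatic_index M).
Definition KL8 (M : ZF) : Prop :=
  every_almost_aleph0_acceptable_graph (@is_H M) (@has_chromatic_number M).

(* Main.v *)
From Stdlib Require Import Classical ClassicalEpsilon Setoid.
Require Import Defs.

(** All nine conditions say that a model's countable families of finite sets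
    can be handled uniformly; the proof is one cycle through each colouring
    condition.

    From Kőnig's Lemma to colourings.  Partial choice functions of a sequence of
    nonempty finite sets form a locally finite tree, and a ray in it yields a
    full choice function ([KL_choice]).  Choosing a linear order on each term of
    a sequence of finite sets makes the union a linear order with finite initial
    segments, hence embeds it in ω ([KL_countable_union]).  The vertex set of a
    connected locally finite graph is the union of its finite levels around a
    root, and its edges are similarly exhausted, so vertices and edges can be
    coloured injectively by natural numbers.  An injective colouring is proper
    and distinguishing; for edges the latter uses that an infinite connected
    graph has no component consisting of a single edge ([KL_imp_KL2]).

    From arbitrary graphs to the attached graphs.  The graphs built from a family
    of finite sets are themselves infinite, locally finite and connected
    ([graphs_to_G], [graphs_to_H]).

    From the attached graphs back to Kőnig's Lemma.  Two elements of one member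
    of the family are exchanged by an automorphism of the first graph, their
    edges to the backbone share an endpoint, and they are adjacent in the second
    graph.  So each kind of colouring is injective on each member of the family
    ([separable]): the finite sets are linearly ordered simultaneously, by
    ordinals.  Applied to the spheres around a vertex, this replaces choice in
    the usual proof of Kőnig's Lemma: always move outwards to the least coloured
    neighbour with infinitely many descendants ([ray_of_separable]).

    Everything takes place inside a model, where a set can be formed only from a
    first-order formula.  Each construction therefore comes with a proof that its
    defining predicate is definable; closure lemmas and the tactic
    [definability] reduce this to the shape of the predicate. *)

(** * Definable predicates and separation *)

Section Definability.

Context {M : ZF}.
Implicit Types (P Q : (nat -> M) -> Prop) (t s : (nat -> M) -> M).

Fixpoint ren (f : nat -> nat) (p : formula) : formula :=
  let up := fun n => match n with O => O | S m => S (f m) end in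
  match p with
  | fMem i j => fMem (f i) (f j)
  | fEq i j => fEq (f i) (f j)
  | fFalse => fFalse
  | fAnd p q => fAnd (ren f p) (ren f q)
  | fOr p q => fOr (ren f p) (ren f q)
  | fImp p q => fImp (ren f p) (ren f q)
  | fAll p => fAll (ren up p)
  | fEx p => fEx (ren up p)
  end.

Lemma sat_ren p : forall f (e e' : nat -> M),
  (forall n, e (f n) = e' n) -> (sat mem e (ren f p) <-> sat mem e' p).
Proof.
  induction p; intros f e e' H; simpl; try (rewrite !H; tauto);
    try (rewrite (IHp1 _ _ _ H), (IHp2 _ _ _ H)); try tauto.
  - split; intros K x; specialize (K x); revert K; apply IHp; intros [|n]; simpl; auto.
  - split; intros [x K]; exists x; revert K; apply IHp; intros [|n]; simpl; auto.
Qed.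

Lemma sat_ext p (e e' : nat -> M) :
  (forall n, e n = e' n) -> (sat mem e p <-> sat mem e' p).
Proof.
  intro H. transitivity (sat mem e (ren (fun n => n) p)).
  - symmetry; apply sat_ren; auto.
  - apply sat_ren; auto.
Qed.

(** Elements of the model that occur in a predicate are parameters: the formula
    sees them in slots of its own, besides those of the variables. *)
Definition fill (r : nat -> nat + M) (e : nat -> M) (n : nat) : M :=
  match r n with inl i => e i | inr a => a end.

(** Predicates are kept as meanings, with a formula only asserted to exist, so
    that closure under each logical connective can be used by unification. *)
Definition definable P : Prop := exists p r, forall e, sat mem (fill r e) p <-> P e.

(** Operations are definable through their graphs, with the value as variable 0. *)
Definition definable_op t : Prop := definable (fun e => e 0 = t (fun n => e (S n))).

Lemma definable_ext P Q : (forall e, P e <-> Q e) -> definable P -> definable Q.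
Proof.
  intros H [p [r K]]. exists p, r. intro e. rewrite K. apply H.
Qed.

(** Excluded middle turns a closed proposition into a truth value. *)
Lemma definable_const (A : Prop) : definable (fun _ => A).
Proof.
  destruct (classic A) as [H|H].
  - exists (fImp fFalse fFalse), (fun n => inl n). intro e; simpl; tauto.
  - exists fFalse, (fun n => inl n). intro e; simpl; tauto.
Qed.

(** Two formulas are combined after moving their slots to the even and to the odd
    numbers, which keeps their parameters apart. *)
Lemma even_odd_slot (A : Type) (r1 r2 : nat -> A) : exists r,
  (forall n, r (n + n) = r1 n) /\ (forall n, r (S (n + n)) = r2 n).
Proof.
  assert (E : forall n, Nat.even (n + n) = true /\ Nat.div2 (n + n) = n
                        /\ Nat.even (S (n + n)) = false /\ Nat.div2 (S (n + n)) = n).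
  { induction n as [|n [H1 [H2 [H3 H4]]]]; [auto|].
    replace (S n + S n) with (S (S (n + n))) by (simpl; rewrite <- plus_n_Sm; reflexivity).
    repeat split; [exact H1|simpl; f_equal; exact H2|exact H3|].
    change (S (Nat.div2 (S (n + n))) = S n). f_equal; exact H4. }
  exists (fun n => if Nat.even n then r1 (Nat.div2 n) else r2 (Nat.div2 n)).
  split; intro n; destruct (E n) as [H1 [H2 [H3 H4]]].
  - rewrite H1, H2; reflexivity.
  - rewrite H3, H4; reflexivity.
Qed.

Lemma definable_bin (op : formula -> formula -> formula) (bop : Prop -> Prop -> Prop) P Q :
  (forall (e : nat -> M) p q, sat mem e (op p q) <-> bop (sat mem e p) (sat mem e q)) ->
  (forall A A' B B' : Prop, (A <-> A') -> (B <-> B') -> (bop A B <-> bop A' B')) ->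
  definable P -> definable Q -> definable (fun e => bop (P e) (Q e)).
Proof.
  intros Hop Hb [p1 [r1 H1]] [p2 [r2 H2]].
  destruct (even_odd_slot _ r1 r2) as [r [R1 R2]].
  exists (op (ren (fun n => n + n) p1) (ren (fun n => S (n + n)) p2)), r.
  intro e. rewrite Hop. apply Hb.
  - rewrite <- H1. apply sat_ren. intro n. unfold fill. rewrite R1; reflexivity.
  - rewrite <- H2. apply sat_ren. intro n. unfold fill. rewrite R2; reflexivity.
Qed.

Lemma definable_and P Q : definable P -> definable Q -> definable (fun e => P e /\ Q e).
Proof. apply (definable_bin fAnd and); simpl; tauto. Qed.

Lemma definable_or P Q : definable P -> definable Q -> definable (fun e => P e \/ Q e).
Proof. apply (definable_bin fOr or); simpl; tauto. Qed.

Lemma definable_imp P Q : definable P -> definable Q -> definable (fun e => P e -> Q e).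
Proof. apply (definable_bin fImp (fun A B => A -> B)); simpl; tauto. Qed.

Lemma definable_not P : definable P -> definable (fun e => ~ P e).
Proof. intro H. exact (definable_imp _ _ H (definable_const False)). Qed.

Lemma definable_iff P Q : definable P -> definable Q -> definable (fun e => P e <-> Q e).
Proof. apply (definable_bin (fun p q => fAnd (fImp p q) (fImp q p)) iff); simpl; tauto. Qed.

(** A quantifier binds slot 0 of the formula, whereas variable 0 of the predicate
    may occupy any set of slots: these are merged. *)
Lemma definable_bind p (r : nat -> nat + M) : exists q r', forall e x,
  sat mem (scons x (fill r' e)) q <-> sat mem (fill r (scons x e)) p.
Proof.
  exists (ren (fun n => match r n with inl O => O | _ => S n end) p),
         (fun n => match r n with inl (S i) => inl i | inl O => inl O | inr a => inr a end).
  intros e x. apply sat_ren. intro n. unfold fill, scons.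
  destruct (r n) as [[|i]|a] eqn:E; rewrite ?E; reflexivity.
Qed.

Lemma definable_ex_scons P : definable P -> definable (fun e => exists x, P (scons x e)).
Proof.
  intros [p [r H]]. destruct (definable_bind p r) as [q [r' K]].
  exists (fEx q), r'. intro e; simpl.
  split; intros [x L]; exists x; [apply H, K, L|apply K, H, L].
Qed.

Lemma definable_all_scons P : definable P -> definable (fun e => forall x, P (scons x e)).
Proof.
  intros [p [r H]]. destruct (definable_bind p r) as [q [r' K]].
  exists (fAll q), r'. intro e; simpl.
  split; intros L x; [apply H, K, L|apply K, H, L].
Qed.

Lemma definable_ex (Q : (nat -> M) -> M -> Prop) :
  definable (fun e => Q (fun n => e (S n)) (e 0)) -> definable (fun e => exists x, Q e x).
Proof. apply definable_ex_scons. Qed.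

Lemma definable_all (Q : (nat -> M) -> M -> Prop) :
  definable (fun e => Q (fun n => e (S n)) (e 0)) -> definable (fun e => forall x, Q e x).
Proof. apply definable_all_scons. Qed.

Lemma definable_ren f P : definable P -> definable (fun e => P (fun n => e (f n))).
Proof.
  intros [p [r H]]. exists p, (fun n => match r n with inl i => inl (f i) | inr a => inr a end).
  intro e. rewrite <- (H (fun n => e (f n))). apply sat_ext. intro n. unfold fill.
  destruct (r n); reflexivity.
Qed.

Lemma op_var n : definable_op (fun e => e n).
Proof. exists (fEq 0 (S n)), inl. intro e; simpl; tauto. Qed.

Lemma op_const c : definable_op (fun _ => c).
Proof.
  exists (fEq 0 1), (fun n => match n with O => inl O | _ => inr c end).
  intro e; simpl; tauto.
Qed.

(** An operation inside a predicate is eliminated by naming its value: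
    [R (t e)] holds when some [x] equal to [t e] satisfies [R]. *)
Lemma definable_subst1 (R : M -> Prop) t :
  definable (fun e => R (e 0)) -> definable_op t -> definable (fun e => R (t e)).
Proof.
  intros HR Ht. apply definable_ext with (fun e => exists x, x = t e /\ R x).
  - intro e; split; [intros [x [-> H]]; exact H|eauto].
  - apply definable_ex. apply definable_and; [exact Ht|exact HR].
Qed.

Lemma definable_subst2 (R : M -> M -> Prop) t1 t2 :
  definable (fun e => R (e 0) (e 1)) -> definable_op t1 -> definable_op t2 ->
  definable (fun e => R (t1 e) (t2 e)).
Proof.
  intros HR H1 H2.
  apply definable_ext with (fun e => exists x, x = t2 e /\ exists y, y = t1 e /\ R y x).
  - intro e; split; [intros [x [-> [y [-> H]]]]; exact H|eauto].
  - apply definable_ex, definable_and; [exact H2|].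
    apply definable_ex, definable_and; [|exact HR].
    exact (definable_ren (fun n => match n with O => O | S n => S (S n) end) _ H1).
Qed.

Lemma definable_subst3 (R : M -> M -> M -> Prop) t1 t2 t3 :
  definable (fun e => R (e 0) (e 1) (e 2)) ->
  definable_op t1 -> definable_op t2 -> definable_op t3 ->
  definable (fun e => R (t1 e) (t2 e) (t3 e)).
Proof.
  intros HR H1 H2 H3.
  apply definable_ext with (fun e => exists x, x = t3 e /\ exists y, y = t2 e /\
                             exists z, z = t1 e /\ R z y x).
  - intro e; split; [intros [x [-> [y [-> [z [-> H]]]]]]; exact H|].
    intro H. exists (t3 e). split; [reflexivity|]. eauto.
  - apply definable_ex. apply definable_and; [exact H3|]. apply definable_ex. apply definable_and.
    + exact (definable_ren (fun n => match n with O => O | S n => S (S n) end) _ H2).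
    + apply definable_ex. apply definable_and; [|exact HR].
      exact (definable_ren (fun n => match n with O => O | S n => S (S (S n)) end) _ H1).
Qed.

Lemma op_subst1 (F : M -> M) t :
  definable_op (fun e => F (e 0)) -> definable_op t -> definable_op (fun e => F (t e)).
Proof.
  intros HF Ht. apply (definable_subst2 (fun y x => y = F x)); [exact HF|apply op_var|].
  exact (definable_ren (fun n => match n with O => O | S n => S (S n) end) _ Ht).
Qed.

Lemma op_subst2 (F : M -> M -> M) t1 t2 :
  definable_op (fun e => F (e 0) (e 1)) -> definable_op t1 -> definable_op t2 ->
  definable_op (fun e => F (t1 e) (t2 e)).
Proof.
  intros HF H1 H2. apply (definable_subst3 (fun y x x' => y = F x x')); [exact HF|apply op_var| |].
  - exact (definable_ren (fun n => match n with O => O | S n => S (S n) end) _ H1).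
  - exact (definable_ren (fun n => match n with O => O | S n => S (S n) end) _ H2).
Qed.

Lemma definable_mem t s : definable_op t -> definable_op s -> definable (fun e => t e ∈ s e).
Proof. apply definable_subst2. exists (fMem 0 1), inl. intro e; simpl; tauto. Qed.

Lemma definable_eq t s : definable_op t -> definable_op s -> definable (fun e => t e = s e).
Proof. apply definable_subst2. exists (fEq 0 1), inl. intro e; simpl; tauto. Qed.

End Definability.

(** Hook for closure lemmas about operations introduced further on. *)
Ltac def_user := fail.

Ltac def_step :=
  cbv beta;
  lazymatch goal with
  | |- definable_op (fun _ => ?c) => apply op_const
  | |- definable_op _ => first [apply op_var | def_user]
  | |- definable (fun _ => ?A) => apply definable_const
  | |- definable (fun _ => mem _ _) => apply definable_mem
  | |- definable (fun _ => _ = _) => apply definable_eq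
  | |- definable (fun _ => _ <-> _) => apply definable_iff
  | |- definable (fun _ => _ /\ _) => apply definable_and
  | |- definable (fun _ => _ \/ _) => apply definable_or
  | |- definable (fun _ => ~ _) => apply definable_not
  | |- definable (fun _ => exists _, _) => apply definable_ex
  | |- definable (fun _ => forall _, _) => first [apply definable_imp | apply definable_all]
  | |- definable _ => def_user
  end.
Ltac definability := repeat def_step.

(** * Elementary sets *)

Create HintDb defs.

Section Sets.

Context {M : ZF}.

Lemma ZF_inhabited : inhabited M.
Proof. destruct (zf_infinity M) as [w _]. exact (inhabits w). Qed.

(** Used only for properties with exactly one witness, so it names sets of the
    model and makes no choices among them. *)
Definition the (P : M -> Prop) : M := epsilon ZF_inhabited P.

Lemma the_spec (P : M -> Prop) : (exists x, P x) -> P (the P).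
Proof. apply epsilon_spec. Qed.

Lemma ext (x y : M) : (forall z, z ∈ x <-> z ∈ y) -> x = y.
Proof. apply zf_extensionality. Qed.

Definition sep (a : M) (P : M -> Prop) : M := the (fun b => forall x, x ∈ b <-> x ∈ a /\ P x).

Lemma in_sep (a : M) (P : M -> Prop) (x : M) :
  definable (fun e => P (e 0)) -> (x ∈ sep a P <-> x ∈ a /\ P x).
Proof.
  intros [p [r H]]. refine (the_spec (fun b => forall x, x ∈ b <-> x ∈ a /\ P x) _ x).
  destruct (definable_bind p r) as [q [r' K]].
  destruct (zf_separation q (fill r' (fun _ => a)) a) as [b Hb].
  exists b. intro y. rewrite (Hb y), (K (fun _ => a) y), H. reflexivity.
Qed.

Definition upair (x y : M) : M := the (fun p => forall z, z ∈ p <-> z = x \/ z = y).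
Definition union (x : M) : M := the (fun u => forall z, z ∈ u <-> exists y, y ∈ x /\ z ∈ y).
Definition power (x : M) : M := the (fun p => forall y, y ∈ p <-> subset y x).
Definition sing (x : M) : M := upair x x.
Definition cup (x y : M) : M := union (upair x y).
Definition succ (x : M) : M := cup x (sing x).
Definition pair (x y : M) : M := upair (sing x) (upair x y).
Definition empty : M := the (fun x => forall z, z ∉ x).

Lemma in_upair x y z : z ∈ upair x y <-> z = x \/ z = y.
Proof. exact (the_spec (fun p => forall z, z ∈ p <-> z = x \/ z = y) (zf_pairing x y) z). Qed.

Lemma in_union x z : z ∈ union x <-> exists y, y ∈ x /\ z ∈ y.
Proof.
  exact (the_spec (fun u => forall z, z ∈ u <-> exists y, y ∈ x /\ z ∈ y) (zf_union x) z).
Qed.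

Lemma in_power x y : y ∈ power x <-> subset y x.
Proof. exact (the_spec (fun p => forall y, y ∈ p <-> subset y x) (zf_power x) y). Qed.

Lemma in_sing x z : z ∈ sing x <-> z = x.
Proof. unfold sing. rewrite in_upair. tauto. Qed.

Lemma in_cup x y z : z ∈ cup x y <-> z ∈ x \/ z ∈ y.
Proof.
  unfold cup. rewrite in_union. split.
  - intros [u [Hu Hz]]. apply in_upair in Hu. destruct Hu as [->| ->]; auto.
  - intros [H|H]; [exists x|exists y]; rewrite in_upair; auto.
Qed.

Lemma in_succ x z : z ∈ succ x <-> z ∈ x \/ z = x.
Proof. unfold succ. rewrite in_cup, in_sing. reflexivity. Qed.

Lemma in_empty z : z ∈ empty <-> False.
Proof.
  split; [|tauto]. refine (the_spec (fun x => forall z, z ∉ x) _ z).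
  destruct (zf_infinity M) as [w [[o [_ H]] _]]. exists o; exact H.
Qed.

Lemma is_empty_iff (x : M) : is_empty x <-> x = empty.
Proof.
  split; [|intros -> z; rewrite in_empty; auto].
  intro H. apply ext. intro z. rewrite in_empty. split; [apply H|tauto].
Qed.

Lemma not_empty_iff (x : M) : ~ is_empty x <-> exists z, z ∈ x.
Proof.
  split.
  - intro H. apply NNPP. intro K. apply H. intros z Hz. eauto.
  - intros [z H] K. exact (K z H).
Qed.

Lemma is_upair_iff (p x y : M) : is_upair p x y <-> p = upair x y.
Proof.
  split.
  - intro H. apply ext. intro z. rewrite in_upair. apply H.
  - intros -> z. apply in_upair.
Qed.

Lemma is_pair_iff (p x y : M) : is_pair p x y <-> p = pair x y.
Proof.
  unfold is_pair. split.
  - intro H. apply ext. intro z. rewrite H, !is_upair_iff. unfold pair.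
    rewrite in_upair. reflexivity.
  - intros -> z. unfold pair. rewrite in_upair, !is_upair_iff. reflexivity.
Qed.

Lemma is_succ_iff (y x : M) : is_succ y x <-> y = succ x.
Proof.
  split.
  - intro H. apply ext. intro z. rewrite in_succ. apply H.
  - intros -> z. apply in_succ.
Qed.

Lemma upair_inj (x y x' y' : M) :
  upair x y = upair x' y' -> (x = x' /\ y = y') \/ (x = y' /\ y = x').
Proof.
  intro H.
  assert (A : forall z, (z = x \/ z = y) <-> (z = x' \/ z = y')).
  { intro z. rewrite <- !in_upair, H. reflexivity. }
  pose proof (proj1 (A x) (or_introl eq_refl)).
  pose proof (proj1 (A y) (or_intror eq_refl)).
  pose proof (proj2 (A x') (or_introl eq_refl)).
  pose proof (proj2 (A y') (or_intror eq_refl)).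
  intuition (subst; auto).
Qed.

Lemma upair_comm (x y : M) : upair x y = upair y x.
Proof. apply ext. intro z. rewrite !in_upair. tauto. Qed.

Lemma pair_inj (x y x' y' : M) : pair x y = pair x' y' -> x = x' /\ y = y'.
Proof.
  intro H. apply upair_inj in H. unfold sing in H.
  destruct H as [[H K]|[H K]]; apply upair_inj in H; apply upair_inj in K;
    intuition (subst; auto).
Qed.

Lemma pair_eq_iff (x y x' y' : M) : pair x y = pair x' y' <-> x = x' /\ y = y'.
Proof. split; [apply pair_inj|intros [-> ->]; reflexivity]. Qed.

Lemma app_iff (f x y : M) : app f x y <-> pair x y ∈ f.
Proof.
  split.
  - intros [p [H K]]. apply is_pair_iff in H. subst; exact K.
  - intro H. exists (pair x y). rewrite is_pair_iff. auto.
Qed.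

Lemma adj_iff (E x y : M) : adj E x y <-> upair x y ∈ E.
Proof.
  split.
  - intros [e [H K]]. apply is_upair_iff in H. subst; exact K.
  - intro H. exists (upair x y). rewrite is_upair_iff. auto.
Qed.

Lemma adj_sym (E x y : M) : adj E x y -> adj E y x.
Proof. rewrite !adj_iff, upair_comm. auto. Qed.

Lemma eq_iff_mem (x y : M) : x = y <-> forall z, z ∈ x <-> z ∈ y.
Proof. split; [intros ->; reflexivity|apply ext]. Qed.

Lemma op_upair : definable_op (fun e : nat -> M => upair (e 0) (e 1)).
Proof.
  apply definable_ext with (fun e => forall z, z ∈ e 0 <-> z = e 1 \/ z = e 2); [|definability].
  intro e. rewrite eq_iff_mem. setoid_rewrite in_upair. reflexivity.
Qed.

Lemma op_union : definable_op (fun e : nat -> M => union (e 0)).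
Proof.
  apply definable_ext with (fun e => forall z, z ∈ e 0 <-> exists y, y ∈ e 1 /\ z ∈ y); [|definability].
  intro e. rewrite eq_iff_mem. setoid_rewrite in_union. reflexivity.
Qed.

Lemma op_power : definable_op (fun e : nat -> M => power (e 0)).
Proof.
  apply definable_ext with (fun e => forall z, z ∈ e 0 <-> forall u, u ∈ z -> u ∈ e 1); [|definability].
  intro e. rewrite eq_iff_mem. setoid_rewrite in_power. reflexivity.
Qed.

(** Comprehension terms may occur inside further comprehensions. *)
Lemma op_sep (A : (nat -> M) -> M) (P : (nat -> M) -> M -> Prop) :
  definable_op A -> definable (fun e => P (fun n => e (S n)) (e 0)) ->
  definable_op (fun e => sep (A e) (P e)).
Proof.
  intros HA HP.
  assert (H1 : forall e, definable (fun e' => P e (e' 0))).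
  { intro e. destruct HP as [p [r H]].
    exists p, (fun n => match r n with inl (S i) => inr (e i) | inl O => inl O | inr a => inr a end).
    intro e'. rewrite <- (H (scons (e' 0) e)). apply sat_ext. intro n. unfold fill, scons.
    destruct (r n) as [[|i]|a]; reflexivity. }
  apply definable_ext with (fun e => exists a, a = A (fun n => e (S n)) /\
                      forall z, z ∈ e 0 <-> z ∈ a /\ P (fun n => e (S n)) z).
  - intro e. rewrite eq_iff_mem. split.
    + intros [a [-> H]] z. rewrite H, in_sep; [reflexivity|apply H1].
    + intro H. exists (A (fun n => e (S n))). split; [reflexivity|].
      intro z. rewrite (H z), in_sep; [reflexivity|apply H1].
  - apply definable_ex, definable_and.
    + exact (definable_ren (fun n => match n with O => O | S n => S (S n) end) _ HA).
    + definability.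
      exact (definable_ren (fun n => match n with O => O | S n => S (S (S n)) end) _ HP).
Qed.

End Sets.

#[export] Hint Unfold sing cup succ pair is_empty subset is_upair is_pair is_succ app is_fun
  is_injection is_bijection equinumerous adj is_inductive is_omega card_lt is_finite : defs.

Ltac def_user ::=
  first
  [ apply op_sep
  | apply (op_subst2 upair _ _ op_upair)
  | apply (op_subst1 union _ op_union)
  | apply (op_subst1 power _ op_power)
  | progress autounfold with defs
  ].

Section Functions.

Context {M : ZF}.
Implicit Types A B f x y : M.

Definition prod A B : M :=
  sep (power (power (cup A B))) (fun p => exists x y, x ∈ A /\ y ∈ B /\ p = pair x y).

Lemma in_prod A B p : p ∈ prod A B <-> exists x y, x ∈ A /\ y ∈ B /\ p = pair x y.
Proof.
  unfold prod. rewrite in_sep by definability. split; [tauto|].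
  intro H. split; [|exact H]. destruct H as [x [y [Hx [Hy ->]]]].
  apply in_power. intros z Hz. apply in_power. intros u Hu. apply in_cup.
  unfold pair in Hz. apply in_upair in Hz.
  destruct Hz as [->| ->]; [apply in_sing in Hu|apply in_upair in Hu];
    intuition (subst; auto).
Qed.

Lemma pair_in_prod A B x y : pair x y ∈ prod A B <-> x ∈ A /\ y ∈ B.
Proof.
  rewrite in_prod. split.
  - intros [x' [y' [H [K E]]]]. apply pair_inj in E. destruct E; subst; auto.
  - intros [H K]. exists x, y. auto.
Qed.

Definition graph A B (R : M -> M -> Prop) : M :=
  sep (prod A B) (fun p => exists x y, p = pair x y /\ R x y).

Lemma app_graph A B (R : M -> M -> Prop) x y : definable (fun e => R (e 1) (e 0)) ->
  (app (graph A B R) x y <-> x ∈ A /\ y ∈ B /\ R x y).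
Proof.
  intro HR. rewrite app_iff. unfold graph. rewrite in_sep, pair_in_prod.
  - split; [|intros [H1 [H2 H3]]; eauto 10].
    intros [[H1 H2] [x' [y' [E H]]]]. apply pair_inj in E. destruct E; subst; auto.
  - definability. 
    apply (definable_ren (fun n => match n with O => O | 1 => 1 | S (S n) => S (S (S n)) end) _ HR).
Qed.

(** The union of all values at [x]: defined by separation also where [f] is not a
    function, which makes application a definable operation everywhere. *)
Definition ap f x : M := union (sep (union (union f)) (fun y => pair x y ∈ f)).

Lemma app_fun_dom f A B x y : is_fun f A B -> app f x y -> x ∈ A /\ y ∈ B.
Proof.
  intros [H _] [p [Hp K]]. destruct (H p K) as [x' [y' [Hx [Hy E]]]].
  apply is_pair_iff in Hp, E. subst. apply pair_inj in E. destruct E; subst; auto.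
Qed.

Lemma app_uniq f A B x y y' : is_fun f A B -> app f x y -> app f x y' -> y = y'.
Proof. intros [_ [_ H]]. apply H. Qed.

Lemma ap_eq f A B x y : is_fun f A B -> app f x y -> ap f x = y.
Proof.
  intros Hf Hy. assert (K : forall z, app f x z <-> z = y).
  { intro z; split; [intro Hz; eapply app_uniq; eauto|intros ->; exact Hy]. }
  unfold ap. apply ext. intro z. rewrite in_union. split.
  - intros [u [Hu Hz]]. rewrite in_sep in Hu by definability.
    destruct Hu as [_ Hu]. apply app_iff, K in Hu. subst; exact Hz.
  - intro Hz. exists y. split; [|exact Hz]. rewrite in_sep by definability.
    apply app_iff in Hy. split; [|exact Hy].
    apply in_union. exists (upair x y). split; [|apply in_upair; auto].
    apply in_union. exists (pair x y). split; [exact Hy|].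
    unfold pair. apply in_upair. auto.
Qed.

Lemma app_ap f A B x : is_fun f A B -> x ∈ A -> app f x (ap f x).
Proof.
  intros Hf Hx. destruct (proj1 (proj2 Hf) x Hx) as [y Hy].
  rewrite (ap_eq f A B x y Hf Hy). exact Hy.
Qed.

Lemma ap_in f A B x : is_fun f A B -> x ∈ A -> ap f x ∈ B.
Proof. intros Hf Hx. exact (proj2 (app_fun_dom _ _ _ _ _ Hf (app_ap _ _ _ _ Hf Hx))). Qed.

Lemma app_ap_iff f A B x y : is_fun f A B -> (app f x y <-> x ∈ A /\ y = ap f x).
Proof.
  intro Hf. split.
  - intro H. split; [exact (proj1 (app_fun_dom _ _ _ _ _ Hf H))|].
    symmetry. eapply ap_eq; eauto.
  - intros [H ->]. eapply app_ap; eauto.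
Qed.

Lemma graph_is_fun A B (R : M -> M -> Prop) : definable (fun e => R (e 1) (e 0)) ->
  (forall x, x ∈ A -> exists y, y ∈ B /\ R x y) ->
  (forall x y y', x ∈ A -> y ∈ B -> y' ∈ B -> R x y -> R x y' -> y = y') ->
  is_fun (graph A B R) A B.
Proof.
  intros HR Hex Hun. split; [|split].
  - intros p Hp. unfold graph in Hp. apply in_sep in Hp.
    + destruct Hp as [Hp _]. apply in_prod in Hp. setoid_rewrite is_pair_iff. exact Hp.
    + definability.
      exact (definable_ren (fun n => match n with O => O | 1 => 1 | S (S n) => S (S (S n)) end) _ HR).
  - intros x Hx. destruct (Hex x Hx) as [y [Hy K]]. exists y. apply app_graph; auto.
  - intros x y y' H H'. apply app_graph in H, H'; auto.
    destruct H as [? [? ?]], H' as [? [? ?]]. eauto.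
Qed.

Lemma ap_graph A B (R : M -> M -> Prop) x y : definable (fun e => R (e 1) (e 0)) ->
  is_fun (graph A B R) A B -> x ∈ A -> y ∈ B -> R x y -> ap (graph A B R) x = y.
Proof. intros HR Hf Hx Hy H. apply (ap_eq _ A B); auto. apply app_graph; auto. Qed.

Lemma injection_iff f A B : is_injection f A B <->
  is_fun f A B /\ forall x x', x ∈ A -> x' ∈ A -> ap f x = ap f x' -> x = x'.
Proof.
  unfold is_injection. split; intros [Hf H]; split; auto.
  - intros x x' Hx Hx' E. apply (H x x' (ap f x)).
    + eapply app_ap; eauto.
    + rewrite E. eapply app_ap; eauto.
  - intros x x' y. rewrite !(app_ap_iff _ _ _ _ _ Hf). intros [? ?] [? ?].
    apply H; congruence.
Qed.

Lemma bijection_iff f A B : is_bijection f A B <->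
  is_injection f A B /\ forall y, y ∈ B -> exists x, x ∈ A /\ ap f x = y.
Proof.
  unfold is_bijection. split; intros [[Hf Hi] H]; split; try (split; assumption).
  - intros y Hy. destruct (H y Hy) as [x Hx]. apply (app_ap_iff _ _ _ _ _ Hf) in Hx.
    destruct Hx; eauto.
  - intros y Hy. destruct (H y Hy) as [x [Hx E]]. exists x.
    apply (app_ap_iff _ _ _ _ _ Hf). auto.
Qed.

Definition lam A B (F : M -> M) : M := graph A B (fun x y => y = F x).

Lemma lam_is_fun A B (F : M -> M) : definable_op (fun e => F (e 0)) ->
  (forall x, x ∈ A -> F x ∈ B) -> is_fun (lam A B F) A B.
Proof.
  intros HF H. apply graph_is_fun.
  - exact HF.
  - eauto.
  - congruence.
Qed.

Lemma ap_lam A B (F : M -> M) x : definable_op (fun e => F (e 0)) ->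
  (forall x, x ∈ A -> F x ∈ B) -> x ∈ A -> ap (lam A B F) x = F x.
Proof.
  intros HF H Hx. apply ap_graph; auto. exact (lam_is_fun A B F HF H).
Qed.

Lemma lam_injection A B (F : M -> M) : definable_op (fun e => F (e 0)) ->
  (forall x, x ∈ A -> F x ∈ B) ->
  (forall x x', x ∈ A -> x' ∈ A -> F x = F x' -> x = x') -> is_injection (lam A B F) A B.
Proof.
  intros HF H Hi. apply injection_iff. split; [apply lam_is_fun; auto|].
  intros x x' Hx Hx'. rewrite !ap_lam; auto.
Qed.

Lemma in_union_range f A B i x : is_fun f A B -> i ∈ A -> x ∈ ap f i -> x ∈ union B.
Proof. intros Hf Hi Hx. apply in_union. exists (ap f i). split; auto. eapply ap_in; eauto. Qed.

End Functions.

#[export] Hint Unfold prod graph lam : defs.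

Lemma op_ap {M : ZF} : definable_op (fun e : nat -> M => ap (e 0) (e 1)).
Proof. unfold ap. definability. Qed.

Ltac def_user ::=
  first
  [ apply op_sep
  | apply (op_subst2 upair _ _ op_upair)
  | apply (op_subst1 union _ op_union)
  | apply (op_subst1 power _ op_power)
  | apply (op_subst2 ap _ _ op_ap)
  | progress autounfold with defs
  ].

(** * The natural numbers *)

Section Omega.

Context {M : ZF}.
Implicit Types n m i x y : M.

(** Foundation excludes membership cycles, which spares the usual inductions
    about natural numbers. *)
Lemma mem_irrefl x : x ∉ x.
Proof.
  intro H. destruct (@zf_foundation M (sing x)) as [y [Hy K]].
  - exists x. apply in_sing; auto.
  - apply in_sing in Hy. subst y. apply K. exists x. split; [exact H|apply in_sing; auto].
Qed.

Lemma mem_asym x y : x ∈ y -> y ∉ x.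
Proof.
  intros H H'. destruct (@zf_foundation M (upair x y)) as [z [Hz K]].
  - exists x. apply in_upair; auto.
  - apply K. apply in_upair in Hz. destruct Hz as [->| ->]; [exists y|exists x];
      rewrite in_upair; auto.
Qed.

Definition omega : M := the (fun w => is_omega w).

Lemma inductive_iff (w : M) :
  is_inductive w <-> empty ∈ w /\ forall x, x ∈ w -> succ x ∈ w.
Proof.
  unfold is_inductive. setoid_rewrite is_empty_iff. setoid_rewrite is_succ_iff.
  split; intros [H K]; split.
  - destruct H as [o [-> H]]. exact H.
  - eauto.
  - eauto.
  - intros x y Hx ->. auto.
Qed.

Lemma omega_spec : is_omega omega.
Proof.
  unfold omega. apply (the_spec (fun w => is_omega w)).
  destruct (zf_infinity M) as [w [[o [Ho Eo]] Hs]].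
  assert (Hw : is_inductive w).
  { apply inductive_iff. split.
    - apply is_empty_iff in Eo. subst; exact Ho.
    - intros x Hx. destruct (Hs x Hx) as [y [Hy K]].
      replace (succ x) with y by (apply is_succ_iff; exact K). exact Hy. }
  exists (sep w (fun x => forall v, is_inductive v -> x ∈ v)).
  assert (Dv : definable (fun e : nat -> M => forall v, is_inductive v -> e 0 ∈ v)) by definability.
  split.
  - apply inductive_iff. split.
    + rewrite in_sep by exact Dv. split; [apply inductive_iff, Hw|].
      intros v Hv. apply inductive_iff, Hv.
    + intros x Hx. rewrite in_sep in * by exact Dv. destruct Hx as [Hx K]. split.
      * apply inductive_iff; auto.
      * intros v Hv. pose proof Hv as Hv'. apply inductive_iff in Hv'. apply Hv', K, Hv.
  - intros v Hv x Hx. rewrite in_sep in Hx by exact Dv. apply Hx, Hv.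
Qed.

Lemma is_omega_iff (w : M) : is_omega w <-> w = omega.
Proof.
  split; [|intros ->; apply omega_spec].
  intros [H K]. destruct omega_spec as [H' K']. apply ext. intro z. split; auto.
  - apply K, H'.
  - apply K', H.
Qed.

Lemma zero_in_omega : empty ∈ omega.
Proof. apply inductive_iff, omega_spec. Qed.

Lemma succ_in_omega n : n ∈ omega -> succ n ∈ omega.
Proof. apply inductive_iff, omega_spec. Qed.

Lemma omega_ind (P : M -> Prop) : definable (fun e => P (e 0)) ->
  P empty -> (forall n, n ∈ omega -> P n -> P (succ n)) -> forall n, n ∈ omega -> P n.
Proof.
  intros HD H0 HS n Hn. assert (K : n ∈ sep omega P).
  - apply (proj2 omega_spec); [|exact Hn]. apply inductive_iff. split.
    + apply in_sep; auto using zero_in_omega.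
    + intros m Hm. apply in_sep in Hm; auto. destruct Hm. apply in_sep; auto using succ_in_omega.
  - apply in_sep in K; tauto.
Qed.

End Omega.

Ltac omega_induction :=
  match goal with |- forall n, n ∈ omega -> @?P n => apply (omega_ind P) end; cbv beta.

Section Naturals.

Context {M : ZF}.
Implicit Types n m i x y : M.

Lemma omega_trans n m : n ∈ omega -> m ∈ n -> m ∈ omega.
Proof.
  intros Hn. revert m. revert n Hn. omega_induction; [definability| |].
  - intros m Hm. apply in_empty in Hm. tauto.
  - intros n Hn IH m Hm. apply in_succ in Hm. destruct Hm as [H| ->]; auto.
Qed.

Lemma nat_trans n m i : n ∈ omega -> m ∈ n -> i ∈ m -> i ∈ n.
Proof.
  intros Hn. revert m i. revert n Hn. omega_induction; [definability| |].
  - intros m i Hm. apply in_empty in Hm. tauto.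
  - intros n Hn IH m i Hm Hi. apply in_succ. apply in_succ in Hm.
    destruct Hm as [H| ->]; eauto.
Qed.

Lemma zero_or_pos n : n ∈ omega -> n = empty \/ empty ∈ n.
Proof.
  revert n. omega_induction; [definability|auto|].
  intros n Hn [->|H]; right; apply in_succ; auto.
Qed.

Lemma succ_le n m : n ∈ omega -> m ∈ n -> succ m = n \/ succ m ∈ n.
Proof.
  intros Hn. revert m. revert n Hn. omega_induction; [definability| |].
  - intros m Hm. apply in_empty in Hm. tauto.
  - intros n Hn IH m Hm. apply in_succ in Hm. rewrite in_succ.
    destruct Hm as [H| ->]; [|auto]. destruct (IH m H); auto.
Qed.

Lemma nat_tricho n m : n ∈ omega -> m ∈ omega -> n ∈ m \/ n = m \/ m ∈ n.
Proof.
  intros Hn. revert m. revert n Hn. omega_induction; [definability| |].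
  - intros m Hm. destruct (zero_or_pos m Hm); auto.
  - intros n Hn IH m Hm. rewrite in_succ. destruct (IH m Hm) as [H|[H|H]]; auto.
    destruct (succ_le m n Hm H); auto.
Qed.

Lemma succ_inj n m : succ n = succ m -> n = m.
Proof.
  intro H. assert (H1 : n ∈ succ m) by (rewrite <- H; apply in_succ; auto).
  assert (H2 : m ∈ succ n) by (rewrite H; apply in_succ; auto).
  apply in_succ in H1, H2. destruct H1 as [H1|H1]; auto. destruct H2 as [H2|H2]; auto.
  destruct (mem_asym _ _ H1 H2).
Qed.

Lemma succ_not_empty n : succ n <> empty.
Proof. intro H. apply (proj1 (in_empty n)). rewrite <- H. apply in_succ; auto. Qed.

Lemma succ_mono n m : m ∈ omega -> n ∈ m -> succ n ∈ succ m.
Proof. intros Hm H. apply in_succ. destruct (succ_le m n Hm H); auto. Qed.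

Lemma succ_mono_inv n m : n ∈ omega -> succ m ∈ succ n -> m ∈ n.
Proof.
  intros Hn H. apply in_succ in H. destruct H as [H|H].
  - apply (nat_trans n (succ m)); auto. apply in_succ; auto.
  - rewrite <- H. apply in_succ; auto.
Qed.

Lemma omega_ordinal : is_ordinal (@omega M).
Proof.
  split; [|split; [|split; [|split]]].
  - intros x Hx y. apply omega_trans, Hx.
  - intros x _. apply mem_irrefl.
  - intros x y z _ _ Hz H K. exact (nat_trans z y x Hz K H).
  - intros x y. apply nat_tricho.
  - intros s Hs Hne. apply not_empty_iff in Hne.
    destruct (@zf_foundation M s Hne) as [m [Hm K]]. exists m. split; auto.
    intros x Hx. destruct (nat_tricho m x) as [H|[H|H]]; auto. destruct K. eauto.
Qed.

Lemma least_ordinal (k : M) (P : M -> Prop) : is_ordinal k -> definable (fun e => P (e 0)) ->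
  (exists x, x ∈ k /\ P x) ->
  exists m, m ∈ k /\ P m /\ forall x, x ∈ k -> P x -> m = x \/ m ∈ x.
Proof.
  intros [_ [_ [_ [_ H]]]] HD [x [Hx Px]].
  destruct (H (sep k P)) as [m [Hm K]].
  - intros z Hz. apply in_sep in Hz; tauto.
  - apply not_empty_iff. exists x. apply in_sep; auto.
  - apply in_sep in Hm; auto. destruct Hm. exists m. repeat split; auto.
    intros z Hz Pz. apply K, in_sep; auto.
Qed.

Lemma least_nat (P : M -> Prop) : definable (fun e => P (e 0)) -> (exists n, n ∈ omega /\ P n) ->
  exists m, m ∈ omega /\ P m /\ forall n, n ∈ m -> ~ P n.
Proof.
  intros HD H. destruct (least_ordinal omega P omega_ordinal HD H) as [m [Hm [Pm K]]].
  exists m. repeat split; auto. intros n Hn Pn.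
  destruct (K n (omega_trans m n Hm Hn) Pn) as [->|L].
  - exact (mem_irrefl n Hn).
  - exact (mem_asym _ _ L Hn).
Qed.

(** The function defined by iteration is the least set of pairs containing
    [(0, a)] and closed under steps of [R]. *)
Lemma recursion (X a : M) (R : M -> M -> Prop) : definable (fun e => R (e 1) (e 0)) ->
  a ∈ X -> (forall x, x ∈ X -> exists y, y ∈ X /\ R x y) ->
  (forall x y y', x ∈ X -> y ∈ X -> y' ∈ X -> R x y -> R x y' -> y = y') ->
  exists r, is_fun r omega X /\ ap r empty = a /\
    forall n, n ∈ omega -> R (ap r n) (ap r (succ n)).
Proof.
  intros HD Ha Hex Hun.
  set (closed := fun c => pair empty a ∈ c /\
    forall n x y, n ∈ omega -> x ∈ X -> y ∈ X -> pair n x ∈ c -> R x y -> pair (succ n) y ∈ c).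
  set (r := sep (prod omega X) (fun p => forall c, closed c -> p ∈ c)).
  assert (Dr : definable (fun e : nat -> M => forall c, closed c -> e 0 ∈ c)).
  { unfold closed. definability. exact HD. }
  assert (Hr : forall n x, pair n x ∈ r <->
     n ∈ omega /\ x ∈ X /\ forall c, closed c -> pair n x ∈ c).
  { intros n x. unfold r. rewrite in_sep by exact Dr. rewrite pair_in_prod. tauto. }
  assert (r0 : pair empty a ∈ r).
  { apply Hr. split; [apply zero_in_omega|]. split; [exact Ha|]. intros c [Hc _]; exact Hc. }
  assert (rS : forall n x y, y ∈ X -> pair n x ∈ r -> R x y -> pair (succ n) y ∈ r).
  { intros n x y Hy Hp HR. apply Hr in Hp. destruct Hp as [Hn [Hx Hc]].
    apply Hr. split; [apply succ_in_omega, Hn|]. split; [exact Hy|].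
    intros c Kc. apply (proj2 Kc n x y); auto. }
  assert (u0 : forall x, pair empty x ∈ r -> x = a).
  { intros x Hx. apply Hr in Hx. destruct Hx as [_ [Hx Hc]]. apply NNPP. intro Ne.
    assert (K : pair empty x ∈ sep r (fun p => p <> pair empty x)).
    { apply Hc. split.
      - rewrite in_sep by definability. split; [exact r0|]. rewrite pair_eq_iff. intros [_ E]; auto.
      - intros n y y' Hn Hy Hy' Hp HR. rewrite in_sep in * by definability. split.
        + apply (rS n y); tauto.
        + rewrite pair_eq_iff. intros [E _]. exact (succ_not_empty _ E). }
    rewrite in_sep in K by definability. tauto. }
  assert (uS : forall n y, n ∈ omega -> pair (succ n) y ∈ r -> exists x, pair n x ∈ r /\ R x y).
  { intros n y Hn Hy. apply NNPP. intro Ne. apply Hr in Hy. destruct Hy as [_ [Hy Hc]].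
    assert (K : pair (succ n) y ∈ sep r (fun p => p <> pair (succ n) y)).
    { apply Hc. split.
      - rewrite in_sep by definability. split; [exact r0|]. rewrite pair_eq_iff.
        intros [E _]; exact (succ_not_empty _ (eq_sym E)).
      - intros m x y' Hm Hx Hy' Hp HR. rewrite in_sep in * by definability. split.
        + apply (rS m x); tauto.
        + rewrite pair_eq_iff. intros [E ->]. apply succ_inj in E. subst m.
          apply Ne. exists x. tauto. }
    rewrite in_sep in K by definability. tauto. }
  assert (tot : forall n, n ∈ omega -> exists x, pair n x ∈ r).
  { omega_induction; [definability|eauto|].
    intros n Hn [x Hx]. destruct (Hex x) as [y [Hy K]]; [apply Hr in Hx; tauto|].
    exists y. eapply rS; eauto. }
  assert (uniq : forall n, n ∈ omega -> forall x x', pair n x ∈ r -> pair n x' ∈ r -> x = x').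
  { omega_induction; [definability| |].
    - intros x x' H H'. rewrite (u0 x H), (u0 x' H'). reflexivity.
    - intros n Hn IH x x' H H'. destruct (uS n x Hn H) as [y [Hy K]].
      destruct (uS n x' Hn H') as [y' [Hy' K']]. pose proof (IH y y' Hy Hy'). subst y'.
      apply Hr in H, H', Hy. apply (Hun y); tauto. }
  assert (fr : is_fun r omega X).
  { split; [|split].
    - intros p Hp. unfold r in Hp. apply in_sep in Hp; [|exact Dr]. destruct Hp as [Hp _].
      apply in_prod in Hp. setoid_rewrite is_pair_iff. exact Hp.
    - intros n Hn. destruct (tot n Hn) as [x Hx]. exists x. apply app_iff, Hx.
    - intros n x x'. rewrite !app_iff. intros H H'. apply (uniq n); auto. apply Hr in H; tauto. }
  exists r. split; [exact fr|]. split.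
  - apply (ap_eq r omega X); auto. apply app_iff, r0.
  - intros n Hn.
    assert (H : pair (succ n) (ap r (succ n)) ∈ r).
    { apply app_iff. apply (app_ap r omega X); auto using succ_in_omega. }
    destruct (uS n _ Hn H) as [x [Hx K]].
    assert (E : ap r n = x) by (apply (ap_eq r omega X); auto; apply app_iff, Hx).
    rewrite E. exact K.
Qed.

End Naturals.

(** * Finite sets *)

Section Finite.

Context {M : ZF}.
Implicit Types A B C f g n m x y u v a : M.

Lemma definable_is_finite : definable (fun e : nat -> M => is_finite (e 0)).
Proof. definability. Qed.

Lemma finite_iff x : is_finite x <-> exists n, n ∈ omega /\ equinumerous x n.
Proof.
  unfold is_finite, card_lt. split.
  - intros [w [Hw H]]. apply is_omega_iff in Hw. subst; exact H.
  - intro H. exists omega. split; [apply omega_spec|exact H].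
Qed.

Lemma equinumerous_lam A B (F : M -> M) : definable_op (fun e => F (e 0)) ->
  (forall x, x ∈ A -> F x ∈ B) ->
  (forall x x', x ∈ A -> x' ∈ A -> F x = F x' -> x = x') ->
  (forall y, y ∈ B -> exists x, x ∈ A /\ F x = y) -> equinumerous A B.
Proof.
  intros HF H Hi Hs. exists (lam A B F). apply bijection_iff.
  split; [apply lam_injection; auto|]. intros y Hy. destruct (Hs y Hy) as [x [Hx E]].
  exists x. rewrite ap_lam; auto.
Qed.

Lemma equinumerous_refl A : equinumerous A A.
Proof. apply (equinumerous_lam A A (fun x => x)); eauto. apply op_var. Qed.

Lemma equinumerous_sym A B : equinumerous A B -> equinumerous B A.
Proof.
  intros [f Hf]. apply bijection_iff in Hf. destruct Hf as [Hf Hs].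
  apply injection_iff in Hf. destruct Hf as [Hf Hi].
  assert (G : is_fun (graph B A (fun y x => ap f x = y)) B A).
  { apply graph_is_fun; [definability| |].
    - intros y Hy. destruct (Hs y Hy) as [x [Hx E]]. eauto.
    - intros y x x' _ Hx Hx' E E'. apply Hi; congruence. }
  assert (K : forall x, x ∈ A -> ap (graph B A (fun y x => ap f x = y)) (ap f x) = x).
  { intros x Hx. apply ap_graph; auto; [definability|]. apply (ap_in f A B); auto. }
  exists (graph B A (fun y x => ap f x = y)). apply bijection_iff. split.
  - apply injection_iff. split; [exact G|]. intros y y' Hy Hy' E.
    destruct (Hs y Hy) as [x [Hx <-]], (Hs y' Hy') as [x' [Hx' <-]].
    rewrite !K in E by assumption. subst; reflexivity.
  - intros x Hx. exists (ap f x). split; [apply (ap_in f A B); auto|]. auto.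
Qed.

Lemma equinumerous_trans A B C : equinumerous A B -> equinumerous B C -> equinumerous A C.
Proof.
  intros [f Hf] [g Hg]. apply bijection_iff in Hf, Hg.
  destruct Hf as [Hf Sf], Hg as [Hg Sg].
  apply injection_iff in Hf, Hg. destruct Hf as [Hf If], Hg as [Hg Ig].
  apply (equinumerous_lam A C (fun x => ap g (ap f x))); [definability| | |].
  - intros x Hx. apply (ap_in g B C); auto. apply (ap_in f A B); auto.
  - intros x x' Hx Hx' E. apply If; auto. apply Ig; auto; apply (ap_in f A B); auto.
  - intros z Hz. destruct (Sg z Hz) as [y [Hy <-]], (Sf y Hy) as [x [Hx <-]]. eauto.
Qed.

Lemma equinumerous_injection A B : equinumerous A B -> exists f, is_injection f A B.
Proof. intros [f [Hf _]]. eauto. Qed.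

Lemma finite_empty : is_finite (@empty M).
Proof. apply finite_iff. exists empty. split; [apply zero_in_omega|apply equinumerous_refl]. Qed.

Definition insert a x : M := cup x (sing a).

Lemma in_insert a x u : u ∈ insert a x <-> u ∈ x \/ u = a.
Proof. unfold insert. rewrite in_cup, in_sing. reflexivity. Qed.

Lemma insert_idem a x : a ∈ x -> insert a x = x.
Proof. intro H. apply ext. intro u. rewrite in_insert. intuition (subst; auto). Qed.

Definition remove a x : M := sep x (fun u => u <> a).

Lemma in_remove a x u : u ∈ remove a x <-> u ∈ x /\ u <> a.
Proof. apply (in_sep x (fun u => u <> a)). definability. Qed.

Lemma insert_remove a x : a ∈ x -> insert a (remove a x) = x.
Proof.
  intro H. apply ext. intro u. rewrite in_insert, in_remove.
  destruct (classic (u = a)); intuition (subst; auto).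
Qed.

Lemma remove_absent a x : a ∉ x -> remove a x = x.
Proof.
  intro H. apply ext. intro u. rewrite in_remove.
  split; [tauto|]. intro Hu. split; [exact Hu|]. intros ->. auto.
Qed.

(** Adding one argument to a function is the step common to enumerating finite
    sets, prolonging paths and prolonging partial choice functions. *)
Lemma extend_fun f A B C a b : is_fun f A B -> subset B C -> a ∉ A -> b ∈ C ->
  exists g, is_fun g (insert a A) C /\ (forall x, x ∈ A -> ap g x = ap f x) /\ ap g a = b.
Proof.
  intros Hf HB Ha Hb.
  set (R := fun u v => (u ∈ A /\ v = ap f u) \/ (u = a /\ v = b)).
  assert (HR : definable (fun e : nat -> M => R (e 1) (e 0))) by (unfold R; definability).
  assert (V : forall u, u ∈ A -> ap f u ∈ C) by (intros u Hu; apply HB, (ap_in f A B); auto).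
  assert (G : is_fun (graph (insert a A) C R) (insert a A) C).
  { apply graph_is_fun; [exact HR| |].
    - intros u Hu. apply in_insert in Hu. destruct Hu as [Hu| ->].
      + exists (ap f u). split; [auto|left; auto].
      + exists b. split; [auto|right; auto].
    - unfold R. intros u v v' _ _ _ [[K1 K2]|[K1 K2]] [[L1 L2]|[L1 L2]]; subst; tauto. }
  exists (graph (insert a A) C R). split; [exact G|split].
  - intros u Hu. apply ap_graph; auto; [apply in_insert; auto|left; auto].
  - apply ap_graph; auto; [apply in_insert; auto|right; auto].
Qed.

Lemma extend_injection f A B C a b : is_injection f A B -> subset B C -> a ∉ A -> b ∈ C ->
  (forall x, x ∈ A -> ap f x <> b) ->
  exists g, is_injection g (insert a A) C /\ (forall x, x ∈ A -> ap g x = ap f x) /\ ap g a = b.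
Proof.
  intros Hf HB Ha Hb Nb. apply injection_iff in Hf. destruct Hf as [Hf Hi].
  destruct (extend_fun f A B C a b Hf HB Ha Hb) as [g [Hg [Gx Ga]]].
  exists g. split; [|split; auto]. apply injection_iff. split; [exact Hg|].
  intros u u' Hu Hu'. apply in_insert in Hu, Hu'.
  destruct Hu as [Hu| ->], Hu' as [Hu'| ->]; rewrite ?Ga, ?Gx by assumption; auto.
  - intro E. destruct (Nb u Hu E).
  - intro E. destruct (Nb u' Hu' (eq_sym E)).
Qed.

Lemma finite_insert a x : is_finite x -> is_finite (insert a x).
Proof.
  intro H. destruct (classic (a ∈ x)) as [Ha|Ha]; [rewrite insert_idem; auto|].
  apply finite_iff in H. destruct H as [n [Hn [f Hf]]]. apply finite_iff.
  apply bijection_iff in Hf. destruct Hf as [Hf Hs].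
  exists (succ n). split; [apply succ_in_omega, Hn|].
  destruct (extend_injection f x n (succ n) a n) as [g [Hg [Gx Ga]]]; auto.
  - intros i Hi. apply in_succ; auto.
  - apply in_succ; auto.
  - intros u Hu E. apply (mem_irrefl n). rewrite <- E at 1.
    apply (ap_in f x n); auto. apply Hf.
  - exists g. apply bijection_iff. split; [exact Hg|].
    intros v Hv. apply in_succ in Hv. destruct Hv as [Hv| ->].
    + destruct (Hs v Hv) as [u [Hu E]]. exists u. rewrite Gx, in_insert by assumption. auto.
    + exists a. rewrite in_insert. auto.
Qed.

(** By induction on the number of elements, removing the last one in an
    enumeration. *)
Lemma finite_ind (P : M -> Prop) : definable (fun e => P (e 0)) -> P empty ->
  (forall x a, is_finite x -> P x -> a ∉ x -> P (insert a x)) -> forall x, is_finite x -> P x.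
Proof.
  intros HD H0 HS x Hx.
  assert (K : forall n, n ∈ omega -> forall x f, is_bijection f x n -> P x).
  { omega_induction.
    - definability. exact (definable_ren (fun _ => 1) _ HD).
    - intros y f Hf. apply bijection_iff in Hf. destruct Hf as [Hf _].
      replace y with (@empty M); [exact H0|]. symmetry. apply is_empty_iff. intros u Hu.
      apply (in_empty (ap f u)). eapply ap_in; [apply Hf|exact Hu].
    - intros n Hn IH y f Hf. apply bijection_iff in Hf. destruct Hf as [Hf Hs].
      apply injection_iff in Hf. destruct Hf as [Hf Hi].
      destruct (Hs n) as [a [Ha E]]; [apply in_succ; auto|].
      assert (V : forall u, u ∈ remove a y -> ap f u ∈ n).
      { intros u Hu. apply in_remove in Hu. destruct Hu as [Hu Ne].
        pose proof (ap_in f y (succ n) u Hf Hu) as L. apply in_succ in L.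
        destruct L as [L|L]; auto. destruct Ne. apply Hi; congruence. }
      rewrite <- (insert_remove a y Ha).
      assert (B : equinumerous (remove a y) n).
      { apply (equinumerous_lam _ _ (fun u => ap f u)); [definability|exact V| |].
        - intros u u' Hu Hu'. apply in_remove in Hu, Hu'. apply Hi; tauto.
        - intros v Hv. destruct (Hs v) as [u [Hu Eu]]; [apply in_succ; auto|].
          exists u. rewrite in_remove. repeat split; auto. intros ->.
          apply (mem_irrefl n). congruence. }
      apply HS.
      + apply finite_iff. eauto.
      + destruct B as [g Hg]. exact (IH _ g Hg).
      + rewrite in_remove. tauto. }
  apply finite_iff in Hx. destruct Hx as [n [Hn [f Hf]]]. exact (K n Hn x f Hf).
Qed.

End Finite.

Ltac finite_induction :=
  match goal with |- forall x, is_finite x -> @?P x => apply (finite_ind P) end; cbv beta.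

#[export] Hint Unfold insert remove : defs.

Ltac def_user ::=
  first
  [ apply op_sep
  | apply (op_subst2 upair _ _ op_upair)
  | apply (op_subst1 union _ op_union)
  | apply (op_subst1 power _ op_power)
  | apply (op_subst2 ap _ _ op_ap)
  | apply (definable_subst1 (@is_finite _) _ definable_is_finite)
  | progress autounfold with defs
  ].

Section FiniteTheory.

Context {M : ZF}.
Implicit Types A B C f g n m x y u v a : M.

Lemma finite_subset x y : is_finite x -> subset y x -> is_finite y.
Proof.
  intro Hx. revert y. revert x Hx. finite_induction; [definability| |].
  - intros y Hy. replace y with (@empty M); [apply finite_empty|].
    symmetry. apply is_empty_iff. intros u Hu. exact (proj1 (in_empty u) (Hy u Hu)).
  - intros x a _ IH _ y Hy.
    assert (K : is_finite (remove a y)).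
    { apply IH. intros u Hu. apply in_remove in Hu. destruct Hu as [Hu Ne].
      apply Hy, in_insert in Hu. tauto. }
    destruct (classic (a ∈ y)) as [Ha|Ha].
    + rewrite <- (insert_remove a y Ha). apply finite_insert, K.
    + rewrite <- (remove_absent a y Ha). exact K.
Qed.

Lemma finite_cup x y : is_finite x -> is_finite y -> is_finite (cup x y).
Proof.
  intro Hx. revert y. finite_induction; [definability| |].
  - apply (finite_subset x); auto. intros u Hu. apply in_cup in Hu.
    rewrite in_empty in Hu. tauto.
  - intros y a _ IH _. apply (finite_subset (insert a (cup x y))); [apply finite_insert, IH|].
    intro u. rewrite in_insert, !in_cup, in_insert. tauto.
Qed.

Lemma finite_sing a : is_finite (sing a).
Proof.
  apply (finite_subset (insert a empty)); [apply finite_insert, finite_empty|].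
  intro u. rewrite in_insert, in_sing. auto.
Qed.

(** Covers images, unions and preimages at once: a definable relation with
    finite fibres takes finite sets to finite sets. *)
Lemma finite_relation (R : M -> M -> Prop) x : definable (fun e => R (e 1) (e 0)) -> is_finite x ->
  (forall u, u ∈ x -> exists y, is_finite y /\ forall v, R u v -> v ∈ y) ->
  exists y, is_finite y /\ forall u v, u ∈ x -> R u v -> v ∈ y.
Proof.
  intro HR. revert x. finite_induction.
  - definability.
    + exact (definable_ren (fun k => match k with O => O | S k => S (S k) end) _ HR).
    + exact HR.
  - intros _. exists empty. split; [apply finite_empty|].
    intros u v Hu. apply in_empty in Hu. tauto.
  - intros x a _ IH _ H. destruct IH as [y [Hy K]].
    { intros u Hu. apply H, in_insert; auto. }
    destruct (H a) as [z [Hz L]]; [apply in_insert; auto|].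
    exists (cup y z). split; [apply finite_cup; auto|].
    intros u v Hu Huv. apply in_cup. apply in_insert in Hu.
    destruct Hu as [Hu| ->]; eauto.
Qed.

Lemma finite_image (R : M -> M -> Prop) x : definable (fun e => R (e 1) (e 0)) -> is_finite x ->
  (forall u v v', u ∈ x -> R u v -> R u v' -> v = v') ->
  exists y, is_finite y /\ forall u v, u ∈ x -> R u v -> v ∈ y.
Proof.
  intros HR Hx H. apply finite_relation; auto. intros u Hu.
  destruct (classic (exists v, R u v)) as [[v Hv]|N].
  - exists (sing v). split; [apply finite_sing|]. intros v' Hv'. apply in_sing. eauto.
  - exists empty. split; [apply finite_empty|]. intros v Hv. destruct N; eauto.
Qed.

Lemma finite_power x : is_finite x -> is_finite (power x).
Proof.
  revert x. finite_induction; [definability| |].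
  - apply (finite_subset (sing empty)); [apply finite_sing|]. intros u Hu.
    apply in_power in Hu. apply in_sing, is_empty_iff. intros v Hv.
    exact (proj1 (in_empty v) (Hu v Hv)).
  - intros x a _ IH _.
    destruct (finite_image (fun u v => v = insert a u) (power x)) as [y [Hy K]]; auto.
    + definability.
    + congruence.
    + apply (finite_subset (cup (power x) y)); [apply finite_cup; auto|].
      intros u Hu. apply in_cup. rewrite in_power in Hu.
      assert (L : remove a u ∈ power x).
      { apply in_power. intros v Hv. apply in_remove in Hv. destruct Hv as [Hv Ne].
        apply Hu, in_insert in Hv. tauto. }
      destruct (classic (a ∈ u)) as [Ha|Ha].
      * right. apply (K (remove a u)); auto. symmetry. apply insert_remove, Ha.
      * left. rewrite remove_absent in L; auto.
Qed.

Lemma finite_prod x y : is_finite x -> is_finite y -> is_finite (prod x y).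
Proof.
  intros Hx Hy. apply (finite_subset (power (power (cup x y)))).
  - apply finite_power, finite_power, finite_cup; auto.
  - intros p Hp. unfold prod in Hp. apply in_sep in Hp; [tauto|definability].
Qed.

Lemma finite_nat n : n ∈ omega -> is_finite n.
Proof. intro Hn. apply finite_iff. exists n. split; [exact Hn|apply equinumerous_refl]. Qed.

Lemma finite_injection f x y : is_injection f x y -> is_finite y -> is_finite x.
Proof.
  intros Hf Hy. apply injection_iff in Hf. destruct Hf as [Hf Hi].
  destruct (finite_image (fun v u => u ∈ x /\ ap f u = v) y) as [z [Hz K]]; auto.
  - definability.
  - intros v u u' _ [H E] [H' E']. apply Hi; congruence.
  - apply (finite_subset z); auto. intros u Hu. apply (K (ap f u)); auto.
    apply (ap_in f x y); auto.
Qed.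

Lemma finite_bounded x : is_finite x -> subset x omega ->
  exists m, m ∈ omega /\ forall n, n ∈ x -> n ∈ m.
Proof.
  revert x. finite_induction; [definability| |].
  - intros _. exists empty. split; [apply zero_in_omega|]. intros n Hn. apply in_empty in Hn. tauto.
  - intros x a _ IH _ H. destruct IH as [m [Hm K]].
    { intros u Hu. apply H, in_insert; auto. }
    assert (Ha : a ∈ omega) by (apply H, in_insert; auto).
    assert (L : forall i j : M, i ∈ omega -> j ∈ omega -> i ∈ j \/ i = j -> forall n, n ∈ i -> n ∈ j).
    { intros i j Hi Hj [C| ->] n Hn; auto. exact (nat_trans j i n Hj C Hn). }
    destruct (nat_tricho a m Ha Hm) as [C|C].
    + exists m. split; auto. intros n Hn. apply in_insert in Hn. destruct Hn as [Hn| ->]; auto.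
    + exists (succ a). split; [apply succ_in_omega, Ha|]. intros n Hn. apply in_succ.
      apply in_insert in Hn. destruct Hn as [Hn| ->]; auto. left. apply (L m a); auto.
      destruct C; auto.
Qed.

Lemma omega_infinite : ~ is_finite (@omega M).
Proof.
  intro H. destruct (finite_bounded omega H) as [m [Hm K]]; [intros u Hu; exact Hu|].
  exact (mem_irrefl m (K m Hm)).
Qed.

Lemma omega_cardinal : is_cardinal (@omega M).
Proof.
  split; [apply omega_ordinal|]. intros b Hb H. apply omega_infinite.
  apply finite_iff. eauto.
Qed.

Lemma pigeonhole x : is_finite x -> forall f, is_injection f x x ->
  forall y, y ∈ x -> exists u, u ∈ x /\ ap f u = y.
Proof.
  revert x. finite_induction; [definability| |].
  - intros f _ y Hy. apply in_empty in Hy. tauto.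
  - intros x a _ IH Ha f Hf. apply injection_iff in Hf. destruct Hf as [Hf Hi].
    assert (Ia : a ∈ insert a x) by (apply in_insert; auto).
    assert (Ix : forall u, u ∈ x -> u ∈ insert a x) by (intros u Hu; apply in_insert; auto).
    assert (V : forall u, u ∈ insert a x -> ap f u ∈ x \/ ap f u = a).
    { intros u Hu. apply in_insert. apply (ap_in f (insert a x) (insert a x)); auto. }
    (* Sending the preimage of [a] directly to the image of [a] turns [f] into an
       injection of [x] into itself. *)
    set (R := fun u v => (ap f u <> a /\ v = ap f u) \/ (ap f u = a /\ v = ap f a)).
    assert (HR : definable (fun e : nat -> M => R (e 1) (e 0))) by (unfold R; definability).
    assert (Tot : forall u, u ∈ x -> exists v, v ∈ x /\ R u v).
    { intros u Hu. unfold R. destruct (classic (ap f u = a)) as [E|E].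
      - exists (ap f a). split; auto. destruct (V a Ia) as [L|L]; auto.
        destruct Ha. rewrite <- (Hi u a); auto. congruence.
      - exists (ap f u). split; auto. destruct (V u (Ix u Hu)); tauto. }
    assert (G : is_fun (graph x x R) x x).
    { apply graph_is_fun; auto. unfold R.
      intros u v v' _ _ _ [[K1 K2]|[K1 K2]] [[L1 L2]|[L1 L2]]; subst; tauto. }
    assert (GR : forall u, u ∈ x -> R u (ap (graph x x R) u)).
    { intros u Hu. pose proof (app_ap _ _ _ _ G Hu) as L. apply app_graph in L; tauto. }
    assert (GI : is_injection (graph x x R) x x).
    { apply injection_iff. split; [exact G|]. intros u u' Hu Hu' E.
      pose proof (GR u Hu) as L. pose proof (GR u' Hu') as L'. rewrite <- E in L'.
      assert (Na : forall w, w ∈ x -> ap f w <> ap f a).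
      { intros w Hw Ew. apply Ha. rewrite <- (Hi w a); auto. }
      destruct L as [[L1 L2]|[L1 L2]], L' as [[L1' L2']|[L1' L2']].
      - apply Hi; auto. congruence.
      - destruct (Na u Hu). congruence.
      - destruct (Na u' Hu'). congruence.
      - apply Hi; auto. congruence. }
    pose proof (IH _ GI) as S.
    intros y Hy. apply in_insert in Hy. destruct Hy as [Hy| ->].
    + destruct (S y Hy) as [u [Hu E]]. pose proof (GR u Hu) as L. rewrite E in L.
      destruct L as [[L1 L2]|[L1 L2]]; eauto.
    + destruct (V a Ia) as [L|L]; [|eauto].
      destruct (S _ L) as [u [Hu E]]. pose proof (GR u Hu) as L'. rewrite E in L'.
      destruct L' as [[L1 L2]|[L1 L2]]; [|eauto].
      destruct Ha. rewrite (Hi a u); auto.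
Qed.

Lemma no_injection_into_proper_subset f x y a : is_finite y -> subset x y -> a ∈ y -> a ∉ x ->
  ~ is_injection f y x.
Proof.
  intros Hy Hxy Ha Na Hf. apply injection_iff in Hf. destruct Hf as [Hf Hi].
  assert (V : forall u, u ∈ y -> ap f u ∈ x) by (intros u Hu; apply (ap_in f y x); auto).
  destruct (pigeonhole y Hy (lam y y (fun u => ap f u))) with (y := a) as [u [Hu E]]; auto.
  - apply lam_injection; auto. definability.
  - rewrite ap_lam in E; auto; [|definability]. apply Na. rewrite <- E. auto.
Qed.

Lemma nat_equinumerous n m : n ∈ omega -> m ∈ omega -> equinumerous n m -> n = m.
Proof.
  assert (K : forall n m : M, n ∈ omega -> m ∈ n -> ~ equinumerous n m).
  { clear. intros n m Hn Hm H. destruct (equinumerous_injection _ _ H) as [f Hf]. revert Hf.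
    apply (no_injection_into_proper_subset f m n m); auto using finite_nat, mem_irrefl.
    intros i Hi. exact (nat_trans n m i Hn Hm Hi). }
  intros Hn Hm H. destruct (nat_tricho n m Hn Hm) as [L|[L|L]]; auto.
  - destruct (K m n Hm L). apply equinumerous_sym, H.
  - destruct (K n m Hn L H).
Qed.

End FiniteTheory.

(** * Paths and connectedness *)

Section Graphs.

Context {M : ZF}.
Implicit Types V E S p r n m x y u v : M.

Lemma zero_in_succ n : n ∈ omega -> empty ∈ succ n.
Proof. intro Hn. apply in_succ. destruct (zero_or_pos n Hn); auto. Qed.

Lemma is_path_iff V E p x y : is_path V E p x y <->
  exists n, n ∈ omega /\ is_injection p (succ n) V /\ ap p empty = x /\ ap p n = y /\
    forall i, i ∈ n -> adj E (ap p i) (ap p (succ i)).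
Proof.
  split.
  - intros [w [n [n' [Hw [Hn [Hs [Hp [[o [Ho Hx]] [Hy Ha]]]]]]]]].
    apply is_omega_iff in Hw. apply is_succ_iff in Hs. apply is_empty_iff in Ho. subst.
    pose proof (proj1 Hp) as Hf. exists n. repeat split; auto; try apply Hp.
    + eapply ap_eq; eauto.
    + eapply ap_eq; eauto.
    + intros i Hi. apply (Ha i (succ i)); auto; [intro z; apply in_succ| |].
      * apply (app_ap p (succ n) V); auto. apply in_succ; auto.
      * apply (app_ap p (succ n) V); auto. apply succ_mono; auto.
  - intros [n [Hn [Hp [Hx [Hy Ha]]]]]. pose proof (proj1 Hp) as Hf.
    exists omega, n, (succ n). split; [apply omega_spec|]. split; [exact Hn|].
    split; [apply is_succ_iff; auto|]. split; [exact Hp|]. split; [|split].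
    + exists empty. split; [apply is_empty_iff; auto|]. rewrite <- Hx.
      apply (app_ap p (succ n) V); auto using zero_in_succ.
    + rewrite <- Hy. apply (app_ap p (succ n) V); auto. apply in_succ; auto.
    + intros i j u v Hi Hj Hu Hv. apply is_succ_iff in Hj. subst j.
      rewrite <- (ap_eq _ _ _ _ _ Hf Hu), <- (ap_eq _ _ _ _ _ Hf Hv). auto.
Qed.

Lemma is_ray_iff V E r : is_ray V E r <->
  is_injection r omega V /\ forall i, i ∈ omega -> adj E (ap r i) (ap r (succ i)).
Proof.
  split.
  - intros [w [Hw [Hr Ha]]]. apply is_omega_iff in Hw. subst. split; auto.
    intros i Hi. apply (Ha i (succ i)); auto; [intro z; apply in_succ| |];
      (apply (app_ap r omega V); auto using succ_in_omega; apply Hr).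
  - intros [Hr Ha]. exists omega. split; [apply omega_spec|]. split; [exact Hr|].
    intros i j u v Hi Hj Hu Hv. apply is_succ_iff in Hj. subst j.
    rewrite <- (ap_eq _ _ _ _ _ (proj1 Hr) Hu), <- (ap_eq _ _ _ _ _ (proj1 Hr) Hv). auto.
Qed.

Lemma adj_vertices V E u v : is_graph V E -> adj E u v -> u ∈ V /\ v ∈ V /\ u <> v.
Proof.
  intros HG H. apply adj_iff in H. destruct (HG _ H) as [x [y [Hx [Hy [Ne K]]]]].
  apply is_upair_iff, upair_inj in K. destruct K as [[-> ->]|[-> ->]]; auto.
Qed.

Definition adj_closed E S : Prop := forall u v, u ∈ S -> adj E u v -> v ∈ S.

(** A path to [u] is prolonged to a neighbour [v], unless it already visits [v];
    then its initial segment up to [v] is taken. *)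
Lemma paths_adj_closed V E x : is_graph V E -> x ∈ V ->
  x ∈ sep V (fun y => exists p, is_path V E p x y) /\
  adj_closed E (sep V (fun y => exists p, is_path V E p x y)).
Proof.
  intros HG Hx.
  assert (HD : definable (fun e : nat -> M => exists p, is_path V E p x (e 0))).
  { apply definable_ext with (fun e => exists p n, n ∈ omega /\ is_injection p (succ n) V /\
      ap p empty = x /\ ap p n = e 0 /\ forall i, i ∈ n -> adj E (ap p i) (ap p (succ i))).
    - intro e. split; intros [p H]; exists p; apply is_path_iff; exact H.
    - definability. }
  split.
  - apply in_sep; [exact HD|]. split; [exact Hx|].
    exists (lam (succ empty) V (fun _ => x)). apply is_path_iff. exists empty.
    assert (K : empty ∈ succ (@empty M)) by (apply in_succ; auto).
    split; [apply zero_in_omega|]. split; [|split; [|split]].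
    + apply lam_injection; auto; [apply op_const|].
      intros i j Hi Hj _. apply in_succ in Hi, Hj. rewrite in_empty in Hi, Hj.
      intuition congruence.
    + apply (ap_lam (succ empty) V (fun _ => x)); auto. apply op_const.
    + apply (ap_lam (succ empty) V (fun _ => x)); auto. apply op_const.
    + intros i Hi. apply in_empty in Hi. tauto.
  - intros u v Hu Huv. destruct (adj_vertices V E u v HG Huv) as [_ [Hv _]].
    apply in_sep in Hu; [|exact HD]. destruct Hu as [Hu [p Hp]].
    apply in_sep; [exact HD|]. split; [exact Hv|].
    apply is_path_iff in Hp. destruct Hp as [n [Hn [Hp [P0 [Pn Pa]]]]].
    pose proof (proj1 (injection_iff _ _ _) Hp) as [Hf Hi].
    destruct (classic (exists i, i ∈ succ n /\ ap p i = v)) as [[i [Ii Ei]]|N].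
    + (* [v] is already on the path, which is cut there *)
      assert (Io : i ∈ omega) by (apply (omega_trans (succ n)); auto using succ_in_omega).
      assert (Sub : forall j, j ∈ succ i -> j ∈ succ n).
      { intros j Hj. apply in_succ in Hj. destruct Hj as [Hj| ->]; auto.
        apply (nat_trans (succ n) i j); auto using succ_in_omega. }
      assert (HF : forall j, j ∈ succ i -> ap p j ∈ V).
      { intros j Hj. apply (ap_in p (succ n) V); auto. }
      assert (HT : definable_op (fun e : nat -> M => ap p (e 0))) by definability.
      exists (lam (succ i) V (ap p)). apply is_path_iff. exists i. split; [exact Io|].
      assert (Ap : forall j, j ∈ succ i -> ap (lam (succ i) V (ap p)) j = ap p j).
      { intros j Hj. apply ap_lam; auto. }
      split; [apply lam_injection; auto|]. split; [|split].
      * rewrite Ap; auto using zero_in_succ.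
      * rewrite Ap; auto. apply in_succ; auto.
      * intros j Hj. rewrite !Ap; auto using succ_mono; [|apply in_succ; auto].
        apply Pa. apply in_succ in Ii. destruct Ii as [Ii| ->]; auto.
        apply (nat_trans n i j); auto.
    + destruct (extend_injection p (succ n) V V (succ n) v) as [q [Hq [Qx Qa]]]; auto.
      * intros z Hz; exact Hz.
      * apply mem_irrefl.
      * intros i Ii Ei. destruct N; eauto.
      * exists q. apply is_path_iff. exists (succ n). split; [apply succ_in_omega, Hn|].
        split; [exact Hq|]. split; [|split].
        -- rewrite Qx; auto using zero_in_succ.
        -- exact Qa.
        -- intros i Ii. rewrite (Qx i Ii). apply in_succ in Ii. destruct Ii as [Ii| ->].
           ++ rewrite Qx; [auto|]. apply succ_mono; auto.
           ++ rewrite Qa, Pn. exact Huv.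
Qed.

(** A closed set containing another vertex [x] must contain [a] as well, since
    otherwise its complement would be a closed set containing [a] but not [x].
    So the vertices reached by paths from any [x] exhaust the graph. *)
Lemma connected_of_root V E a : is_graph V E -> a ∈ V ->
  (forall S, a ∈ S -> adj_closed E S -> subset V S) -> connected V E.
Proof.
  intros HG Ha H x y Hx Hy.
  destruct (paths_adj_closed V E x HG Hx) as [Kx Kc].
  set (S := sep V (fun y => exists p, is_path V E p x y)) in *.
  assert (HaS : a ∈ S).
  { apply NNPP. intro N.
    assert (K : subset V (sep V (fun z => z ∉ S))).
    { apply H.
      - rewrite in_sep by definability. auto.
      - intros u v Hu Huv. rewrite in_sep in * by definability.
        split; [exact (proj1 (proj2 (adj_vertices V E u v HG Huv)))|].
        intro Hv. apply (proj2 Hu). apply (Kc v u Hv). apply adj_sym, Huv. }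
    specialize (K x Hx). rewrite in_sep in K by definability. tauto. }
  specialize (H S HaS Kc y Hy). apply in_sep in H; [tauto|].
  apply definable_ext with (fun e => exists p n, n ∈ omega /\ is_injection p (succ n) V /\
      ap p empty = x /\ ap p n = e 0 /\ forall i, i ∈ n -> adj E (ap p i) (ap p (succ i))).
  - intro e. split; intros [p K]; exists p; apply is_path_iff; exact K.
  - definability.
Qed.

End Graphs.

(** * Choice from sequences of finite sets *)

Section Choice.

Context {M : ZF}.
Implicit Types V E S f g h i j k n m p r u v x y B U X : M.

Lemma fun_subset_prod f B U : is_fun f B U -> subset f (prod B U).
Proof.
  intros [H _] p Hp. destruct (H p Hp) as [x [y [Hx [Hy E]]]].
  apply is_pair_iff in E. subst. apply pair_in_prod; auto.
Qed.

Lemma fun_ext f g A B : is_fun f A B -> is_fun g A B ->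
  (forall x, x ∈ A -> ap f x = ap g x) -> f = g.
Proof.
  assert (K : forall f g, is_fun f A B -> is_fun g A B ->
    (forall x, x ∈ A -> ap f x = ap g x) -> subset f g).
  { clear. intros f g Hf Hg H p Hp. pose proof (fun_subset_prod f A B Hf p Hp) as Hq.
    apply in_prod in Hq. destruct Hq as [x [y [Hx [_ ->]]]].
    apply app_iff in Hp. rewrite <- (ap_eq f A B x y Hf Hp), (H x Hx).
    apply app_iff, (app_ap g A B); auto. }
  intros Hf Hg H. apply ext. intro p. split; apply K; auto.
  intros x Hx. symmetry. auto.
Qed.

(** Ordered by one-step extension, these functions form a tree rooted at the
    empty function, with [n] as the height. *)
Definition partial_choice A U n f : Prop :=
  n ∈ omega /\ is_fun f n U /\ forall i, i ∈ n -> ap f i ∈ ap A i.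

Hint Unfold partial_choice : defs.

Definition choice_vertices A U : M :=
  sep (power (prod omega U)) (fun f => exists n, partial_choice A U n f).

Definition choice_edges A U : M :=
  sep (power (choice_vertices A U)) (fun e => exists n f g, partial_choice A U n f /\
    partial_choice A U (succ n) g /\ subset f g /\ e = upair f g).

Hint Unfold choice_vertices choice_edges : defs.

Section Tree.

Context (A U : M).
Context (A_sub : forall i, i ∈ omega -> subset (ap A i) U).
Context (A_fin : forall i, i ∈ omega -> is_finite (ap A i)).
Context (A_ne : forall i, i ∈ omega -> exists x, x ∈ ap A i).

Notation pc := (partial_choice A U).
Notation V := (choice_vertices A U).
Notation E := (choice_edges A U).

Lemma in_choice_vertices f : f ∈ V <-> exists n, pc n f.
Proof.
  unfold choice_vertices. rewrite in_sep by definability. split; [tauto|].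
  intro H. split; [|exact H]. destruct H as [n [Hn [Hf _]]]. apply in_power.
  intros p Hp. apply (fun_subset_prod f n U Hf) in Hp. apply in_prod in Hp.
  destruct Hp as [i [y [Hi [Hy ->]]]]. apply pair_in_prod. split; auto.
  exact (omega_trans n i Hn Hi).
Qed.

Lemma adj_choice f g : adj E f g <-> exists n,
  (pc n f /\ pc (succ n) g /\ subset f g) \/ (pc n g /\ pc (succ n) f /\ subset g f).
Proof.
  rewrite adj_iff. unfold choice_edges. rewrite in_sep by definability. split.
  - intros [_ [n [f' [g' [Hf [Hg [Hs E]]]]]]]. exists n.
    apply upair_inj in E. destruct E as [[-> ->]|[-> ->]]; auto.
  - intros [n H]. split.
    + apply in_power. intros u Hu. apply in_upair in Hu. apply in_choice_vertices.
      destruct Hu as [->| ->], H as [[H1 [H2 _]]|[H1 [H2 _]]]; eauto.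
    + exists n. destruct H as [[H1 [H2 H3]]|[H1 [H2 H3]]].
      * exists f, g. auto.
      * exists g, f. rewrite (upair_comm f g). auto.
Qed.

Lemma partial_choice_level n m f : pc n f -> pc m f -> n = m.
Proof.
  assert (K : forall n m, pc n f -> pc m f -> subset n m).
  { clear. intros n m [_ [Hf _]] [_ [Hg _]] i Hi.
    exact (proj1 (app_fun_dom _ _ _ _ _ Hg (app_ap _ _ _ _ Hf Hi))). }
  intros H H'. apply ext. intro i. split; apply K; auto.
Qed.

(** The values of these functions lie in a finite union of the sets chosen from,
    so that the functions lie in a finite power set. *)
Lemma finite_levels n : n ∈ omega ->
  is_finite (sep V (fun f => exists m, m ∈ succ n /\ pc m f)).
Proof.
  intro Hn.
  destruct (finite_relation (fun i v => v ∈ ap A i) n) as [W [HW K]].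
  - definability.
  - apply finite_nat, Hn.
  - intros i Hi. exists (ap A i). split; auto. apply A_fin, (omega_trans n i); auto.
  - apply (finite_subset (power (prod n W))).
    + apply finite_power, finite_prod; auto using finite_nat.
    + intros f Hf. rewrite in_sep in Hf by definability. destruct Hf as [_ [m [Hm [_ [Hf Hc]]]]].
      apply in_power. intros p Hp. pose proof (fun_subset_prod f m U Hf p Hp) as Hq.
      apply in_prod in Hq. destruct Hq as [i [y [Hi [_ ->]]]].
      assert (Hin : i ∈ n).
      { apply in_succ in Hm. destruct Hm as [Hm| ->]; auto. exact (nat_trans n m i Hn Hm Hi). }
      apply pair_in_prod. split; auto. apply app_iff in Hp.
      apply (K i); auto. rewrite <- (ap_eq f m U i y Hf Hp). auto.
Qed.

Lemma partial_choice_zero : pc empty empty.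
Proof.
  split; [apply zero_in_omega|]. split.
  - split; [|split].
    + intros p Hp. apply in_empty in Hp. tauto.
    + intros i Hi. apply in_empty in Hi. tauto.
    + intros x y y' H. apply app_iff, in_empty in H. tauto.
  - intros i Hi. apply in_empty in Hi. tauto.
Qed.

Lemma partial_choice_zero_inv f : pc empty f -> f = empty.
Proof.
  intros [_ [Hf _]]. apply (fun_ext f empty empty U); auto.
  - apply partial_choice_zero.
  - intros i Hi. apply in_empty in Hi. tauto.
Qed.

Lemma partial_choice_exists n : n ∈ omega -> exists f, pc n f.
Proof.
  revert n. omega_induction; [definability| |].
  - exists empty. apply partial_choice_zero.
  - intros n Hn [f [_ [Hf Hc]]]. destruct (A_ne n Hn) as [a Ha].
    destruct (extend_fun f n U U n a) as [g [Hg [Gx Ga]]]; auto.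
    + intros z Hz; exact Hz.
    + apply mem_irrefl.
    + exact (A_sub n Hn a Ha).
    + exists g. split; [apply succ_in_omega, Hn|]. split; [exact Hg|].
      intros i Hi. apply in_succ in Hi. destruct Hi as [Hi| ->]; [rewrite Gx|rewrite Ga]; auto.
Qed.

Lemma partial_choice_restrict n g : n ∈ omega -> pc (succ n) g ->
  exists f, pc n f /\ subset f g.
Proof.
  intros Hn [_ [Hg Hc]].
  assert (I : forall i, i ∈ n -> i ∈ succ n) by (intros i Hi; apply in_succ; auto).
  assert (HF : forall i, i ∈ n -> ap g i ∈ U).
  { intros i Hi. apply (ap_in g (succ n) U); auto. }
  assert (HT : definable_op (fun e : nat -> M => ap g (e 0))) by definability.
  pose proof (lam_is_fun n U (ap g) HT HF) as L.
  exists (lam n U (ap g)). split; [split; [exact Hn|split; [exact L|]]|].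
  - intros i Hi. rewrite ap_lam; auto.
  - intros p Hp. pose proof (fun_subset_prod _ n U L p Hp) as Hq. apply in_prod in Hq.
    destruct Hq as [i [y [Hi [_ ->]]]]. apply app_iff in Hp.
    rewrite <- (ap_eq _ n U i y L Hp), ap_lam; auto.
    apply app_iff, (app_ap g (succ n) U); auto.
Qed.

Lemma choice_graph : is_graph V E.
Proof.
  intros e He. unfold choice_edges in He. rewrite in_sep in He by definability.
  destruct He as [_ [n [f [g [Hf [Hg [_ ->]]]]]]]. exists f, g.
  rewrite !in_choice_vertices, is_upair_iff. repeat split; eauto.
  intros ->. apply (mem_irrefl n).
  rewrite (partial_choice_level n (succ n) g Hf Hg) at 2. apply in_succ; auto.
Qed.

Lemma choice_infinite : ~ is_finite V.
Proof.
  intro H. destruct (finite_image (fun f n => pc n f) V) as [y [Hy K]]; auto.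
  - definability.
  - intros f n m _. apply partial_choice_level.
  - apply (@omega_infinite M), (finite_subset y); auto. intros n Hn.
    destruct (partial_choice_exists n Hn) as [f Hf]. apply (K f); auto.
    apply in_choice_vertices; eauto.
Qed.

Lemma choice_locally_finite : locally_finite V E.
Proof.
  intros f Hf. exists (sep V (fun g => adj E f g)). split.
  - intro g. rewrite in_sep by definability. tauto.
  - apply in_choice_vertices in Hf. destruct Hf as [n Hf].
    apply (finite_subset (sep V (fun g => exists m, m ∈ succ (succ n) /\ pc m g))).
    + apply finite_levels, succ_in_omega, Hf.
    + intros g Hg. rewrite in_sep in * by definability. destruct Hg as [Hg K].
      split; [exact Hg|]. apply adj_choice in K. destruct K as [m [[K1 [K2 _]]|[K1 [K2 _]]]].
      * rewrite (partial_choice_level m n f K1 Hf) in K2. exists (succ n).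
        split; auto. apply in_succ; auto.
      * exists m. split; auto. rewrite <- (partial_choice_level _ n f K2 Hf), !in_succ. auto.
Qed.

Lemma choice_connected : connected V E.
Proof.
  apply (connected_of_root V E empty).
  - apply choice_graph.
  - apply in_choice_vertices. exists empty. apply partial_choice_zero.
  - intros S H0 Hc.
    assert (K : forall n, n ∈ omega -> forall f, pc n f -> f ∈ S).
    { omega_induction; [definability| |].
      - intros f Hf. rewrite (partial_choice_zero_inv f Hf). exact H0.
      - intros n Hn IH g Hg. destruct (partial_choice_restrict n g Hn Hg) as [f [Hf Hs]].
        apply (Hc f); auto. apply adj_choice. eauto. }
    intros f Hf. apply in_choice_vertices in Hf. destruct Hf as [n Hf].
    apply (K n); auto. apply Hf.
Qed.

(** A ray is injective and so leaves every finite union of levels, even if it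
    moves towards the root for a while.  Its vertices need not extend each other:
    the value at [i] is taken from the earliest of them that is defined at [i]. *)
Lemma choice_of_ray r : is_ray V E r ->
  exists f, is_fun f omega U /\ forall n, n ∈ omega -> ap f n ∈ ap A n.
Proof.
  intro Hr. apply is_ray_iff in Hr. destruct Hr as [Hr _].
  pose proof (proj1 (injection_iff _ _ _) Hr) as [Fr Ir].
  assert (Lev : forall k, k ∈ omega -> exists n, pc n (ap r k)).
  { intros k Hk. apply in_choice_vertices, (ap_in r omega V); auto. }
  assert (Un : forall i, i ∈ omega -> exists k, k ∈ omega /\ exists v, app (ap r k) i v).
  { intros i Hi. apply NNPP. intro N.
    pose proof (finite_levels i Hi) as HL.
    set (L := sep V (fun f => exists m, m ∈ succ i /\ pc m f)) in HL.
    apply (@omega_infinite M).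
    apply (finite_injection (lam omega L (ap r)) omega L); auto.
    apply lam_injection; auto; [definability|].
    intros k Hk. unfold L. rewrite in_sep by definability. split; [apply (ap_in r omega V); auto|].
    destruct (Lev k Hk) as [m Hm]. exists m. split; auto. apply in_succ.
    destruct Hm as [Hm [Hf _]]. destruct (nat_tricho m i Hm Hi) as [C|[C|C]]; auto.
    destruct N. exists k. split; auto. exists (ap (ap r k) i). apply (app_ap _ m U); auto. }
  set (R := fun i v => exists k, k ∈ omega /\ app (ap r k) i v /\
     forall j, j ∈ k -> ~ exists w, app (ap r j) i w).
  assert (HR : definable (fun e : nat -> M => R (e 1) (e 0))) by (unfold R; definability).
  assert (Val : forall i v, R i v -> v ∈ ap A i /\ v ∈ U).
  { intros i v [k [Hk [Hv _]]]. destruct (Lev k Hk) as [m [Hm [Hf Hc]]].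
    apply (app_ap_iff _ m U) in Hv; auto. destruct Hv as [Hi ->].
    split; auto. apply (ap_in _ m U); auto. }
  assert (G : is_fun (graph omega U R) omega U).
  { apply graph_is_fun; auto.
    - intros i Hi. destruct (least_nat (fun k => exists v, app (ap r k) i v))
        as [k [Hk [[v Hv] Hm]]]; auto; [definability|].
      assert (K : R i v) by (exists k; auto). exists v. split; [apply (Val i v K)|exact K].
    - intros i v v' Hi _ _ [k [Hk [Hv Hm]]] [k' [Hk' [Hv' Hm']]].
      assert (E : k = k').
      { destruct (nat_tricho k k' Hk Hk') as [C|[C|C]]; auto.
        - destruct (Hm' k C); eauto.
        - destruct (Hm k' C); eauto. }
      subst k'. destruct (Lev k Hk) as [m [_ [Hf _]]]. exact (app_uniq _ _ _ _ _ _ Hf Hv Hv'). }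
  exists (graph omega U R). split; [exact G|]. intros i Hi.
  pose proof (app_ap _ _ _ _ G Hi) as K. apply app_graph in K; auto. apply Val, K.
Qed.

End Tree.

Lemma KL_choice A B : KL M -> is_fun A omega B ->
  (forall i, i ∈ omega -> is_finite (ap A i)) ->
  (forall i, i ∈ omega -> exists x, x ∈ ap A i) ->
  exists f, is_fun f omega (union B) /\ forall n, n ∈ omega -> ap f n ∈ ap A n.
Proof.
  intros HK HA Hf Hne.
  assert (Sub : forall i, i ∈ omega -> subset (ap A i) (union B)).
  { intros i Hi x Hx. exact (in_union_range A omega B i x HA Hi Hx). }
  destruct (HK (choice_vertices A (union B)) (choice_edges A (union B))) as [r Hr];
    eauto using choice_graph, choice_infinite, choice_locally_finite, choice_connected,
      choice_of_ray.
Qed.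

(** ** Countable unions of finite sets *)

Definition strict_order R X : Prop :=
  (forall x, ~ app R x x) /\
  (forall x y z, app R x y -> app R y z -> app R x z) /\
  (forall x y, x ∈ X -> y ∈ X -> app R x y \/ x = y \/ app R y x).

Hint Unfold strict_order : defs.

(** Pulled back from an enumeration by a natural number. *)
Lemma finite_order x : is_finite x ->
  exists R, subset R (prod x x) /\ strict_order R x.
Proof.
  intro H. apply finite_iff in H. destruct H as [n [Hn [f Hf]]].
  apply bijection_iff in Hf. destruct Hf as [Hf _]. apply injection_iff in Hf.
  destruct Hf as [Hf Hi].
  assert (HD : definable (fun e : nat -> M => ap f (e 1) ∈ ap f (e 0))) by definability.
  pose proof (fun u v => app_graph x x (fun u v => ap f u ∈ ap f v) u v HD) as K.
  assert (V : forall u, u ∈ x -> ap f u ∈ omega).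
  { intros u Hu. apply (omega_trans n); auto. apply (ap_in f x n); auto. }
  exists (graph x x (fun u v => ap f u ∈ ap f v)). split; [|split; [|split]].
  - intros p Hp. unfold graph in Hp. rewrite in_sep in Hp by definability. tauto.
  - intros u Hu. apply K in Hu. apply (mem_irrefl (ap f u)). tauto.
  - intros u v w H1 H2. apply K in H1, H2. apply K. repeat split; try tauto.
    apply (nat_trans (ap f w) (ap f v)); try tauto. apply V; tauto.
  - intros u v Hu Hv. rewrite !K.
    destruct (nat_tricho (ap f u) (ap f v)) as [C|[C|C]]; auto 6.
Qed.

(** The embedding sends [x] to the number of its predecessors: if [x] is below [y],
    the predecessors of [x] are a proper subset of those of [y], and a finite set
    does not inject into a proper subset. *)
Lemma injection_of_finite_segments X (lt : M -> M -> Prop) :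
  definable (fun e => lt (e 1) (e 0)) ->
  (forall x, ~ lt x x) -> (forall x y z, lt x y -> lt y z -> lt x z) ->
  (forall x y, x ∈ X -> y ∈ X -> lt x y \/ x = y \/ lt y x) ->
  (forall x, x ∈ X -> is_finite (sep X (fun y => lt y x))) ->
  exists h, is_injection h X omega.
Proof.
  intros HD Irr Tr Tot Fin.
  assert (HD' : definable (fun e : nat -> M => lt (e 0) (e 1))).
  { exact (definable_ren (fun s => match s with O => 1 | _ => O end) _ HD). }
  set (R := fun x n => equinumerous (sep X (fun y => lt y x)) n).
  assert (HR : definable (fun e : nat -> M => R (e 1) (e 0))).
  { unfold R. apply (definable_subst2 (@equinumerous M)); [definability| |apply op_var].
    apply op_sep; [apply op_const|]. apply (definable_subst2 lt); auto using op_var. }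
  assert (Seg : forall x y, y ∈ sep X (fun z => lt z x) <-> y ∈ X /\ lt y x).
  { intros x y. apply (in_sep X (fun z => lt z x)).
    apply (definable_subst2 lt); auto using op_var, op_const. }
  assert (G : is_fun (graph X omega R) X omega).
  { apply graph_is_fun; auto.
    - intros x Hx. apply finite_iff, Fin, Hx.
    - intros x n m _ Hn Hm E E'. apply nat_equinumerous; auto.
      apply equinumerous_trans with (sep X (fun z => lt z x)); auto.
      apply equinumerous_sym, E. }
  assert (Ap : forall x, x ∈ X -> R x (ap (graph X omega R) x)).
  { intros x Hx. pose proof (app_ap _ _ _ _ G Hx) as L. apply app_graph in L; tauto. }
  assert (Lt : forall x y, x ∈ X -> y ∈ X -> lt x y ->
            ap (graph X omega R) x <> ap (graph X omega R) y).
  { intros x y Hx Hy L E.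
    destruct (equinumerous_injection (sep X (fun z => lt z y)) (sep X (fun z => lt z x)))
      as [f Hf].
    - apply equinumerous_trans with (ap (graph X omega R) y); [apply (Ap y Hy)|].
      apply equinumerous_sym. rewrite <- E. apply (Ap x Hx).
    - revert Hf. apply no_injection_into_proper_subset with x; auto.
      + intros z. rewrite !Seg. intros [Hz K]. split; auto. apply (Tr z x y); auto.
      + apply Seg. auto.
      + rewrite Seg. intros [_ K]. exact (Irr x K). }
  exists (graph X omega R). apply injection_iff. split; [exact G|]. intros x y Hx Hy E.
  destruct (Tot x y Hx Hy) as [L|[L|L]]; auto.
  - destruct (Lt x y Hx Hy L E).
  - destruct (Lt y x Hy Hx L (eq_sym E)).
Qed.

(** The sets of linear orders on the given sets are finite and nonempty, so
    Kőnig's Lemma chooses from them.  Elements are compared by the first set that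
    contains them, and within it by the chosen order. *)
Lemma KL_countable_union A B X : KL M -> is_fun A omega B ->
  (forall i, i ∈ omega -> is_finite (ap A i)) ->
  (forall x, x ∈ X -> exists i, i ∈ omega /\ x ∈ ap A i) ->
  exists h, is_injection h X omega.
Proof.
  intros HK HA Fin HX.
  set (ord := fun a => sep (power (prod a a)) (fun R => strict_order R a)).
  assert (Hord : forall a R, R ∈ ord a <-> subset R (prod a a) /\ strict_order R a).
  { intros a R. unfold ord. rewrite in_sep by definability. rewrite in_power. reflexivity. }
  set (W := power (power (prod (union B) (union B)))).
  assert (HT : definable_op (fun e : nat -> M => ord (ap A (e 0)))) by (unfold ord; definability).
  assert (HW : forall i, i ∈ omega -> ord (ap A i) ∈ W).
  { intros i Hi. unfold W. apply in_power. intros R HR. apply Hord in HR.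
    apply in_power. intros p Hp. destruct HR as [HR _]. apply HR, in_prod in Hp.
    destruct Hp as [x [y [Hx [Hy ->]]]]. apply pair_in_prod.
    split; apply (in_union_range A omega B i); auto. }
  destruct (KL_choice (lam omega W (fun i => ord (ap A i))) W) as [f [_ Hf]]; auto.
  - apply lam_is_fun; auto.
  - intros i Hi. rewrite ap_lam; auto. apply (finite_subset (power (prod (ap A i) (ap A i)))).
    + apply finite_power, finite_prod; auto.
    + intros R HR. apply Hord in HR. apply in_power. apply HR.
  - intros i Hi. rewrite ap_lam; auto. destruct (finite_order (ap A i) (Fin i Hi)) as [R HR].
    exists R. apply Hord, HR.
  - assert (Ord : forall i, i ∈ omega -> strict_order (ap f i) (ap A i)).
    { intros i Hi. specialize (Hf i Hi). rewrite ap_lam in Hf; auto. apply Hord in Hf. tauto. }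
    clear Hf.
    set (first := fun u i => i ∈ omega /\ u ∈ ap A i /\ forall j, j ∈ i -> u ∉ ap A j).
    assert (Fex : forall u, u ∈ X -> exists i, first u i).
    { intros u Hu. destruct (least_nat (fun i => u ∈ ap A i)) as [i Hi]; auto.
      - definability.
      - exists i. exact Hi. }
    assert (Fun : forall u i j, first u i -> first u j -> i = j).
    { intros u i j [Hi [Ui Li]] [Hj [Uj Lj]].
      destruct (nat_tricho i j Hi Hj) as [C|[C|C]]; auto.
      - destruct (Lj i C Ui).
      - destruct (Li j C Uj). }
    set (lt := fun u v => exists i j, first u i /\ first v j /\
                 (i ∈ j \/ i = j /\ app (ap f i) u v)).
    assert (Hlt : definable (fun e : nat -> M => lt (e 1) (e 0))).
    { unfold lt, first. definability. }
    assert (Dlt : forall x, definable (fun e : nat -> M => lt (e 0) x)).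
    { intro x. unfold lt, first. definability. }
    apply (injection_of_finite_segments X lt); auto.
    + intros x [i [j [Hi [Hj H]]]]. pose proof (Fun x i j Hi Hj) as E. subst j.
      destruct H as [H|[_ H]]; [exact (mem_irrefl i H)|].
      destruct Hi as [Hi _]. exact (proj1 (Ord i Hi) x H).
    + intros x y z [i [j [Hi [Hj H]]]] [j' [k [Hj' [Hk H']]]].
      pose proof (Fun y j j' Hj Hj') as E. subst j'. exists i, k. split; [exact Hi|].
      split; [exact Hk|].
      destruct H as [H|[-> H]], H' as [H'|[<- H']]; auto.
      * left. destruct Hk as [Hk _]. exact (nat_trans k j i Hk H' H).
      * right. split; auto. destruct Hj as [Hj _]. apply (Ord j Hj) with y; auto.
    + intros x y Hx Hy. destruct (Fex x Hx) as [i Hi], (Fex y Hy) as [j Hj].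
      pose proof Hi as [Oi [Xi _]]. pose proof Hj as [Oj [Yj _]].
      destruct (nat_tricho i j Oi Oj) as [C|[C|C]].
      * left. exists i, j. auto.
      * subst j. destruct (Ord i Oi) as [_ [_ Tot]].
        destruct (Tot x y Xi Yj) as [K|[K|K]]; auto.
        -- left. exists i, i. auto 6.
        -- right. right. exists i, i. auto 6.
      * right. right. exists j, i. auto.
    + intros x Hx. destruct (Fex x Hx) as [i Hi].
      destruct (finite_relation (fun j v => v ∈ ap A j) (succ i)) as [Y [HY K]].
      * definability.
      * apply finite_nat, succ_in_omega, Hi.
      * intros j Hj. exists (ap A j). split; auto. apply Fin.
        apply (omega_trans (succ i)); auto. apply succ_in_omega, Hi.
      * apply (finite_subset Y); auto. intros y Hy. rewrite in_sep in Hy by apply Dlt.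
        destruct Hy as [_ [j [i' [Hj [Hi' H]]]]].
        pose proof (Fun x i i' Hi Hi') as E. subst i'.
        apply (K j); [|apply Hj]. apply in_succ. destruct H as [H|[H _]]; auto.
Qed.

End Choice.

(** * Levels of a locally finite connected graph *)

Section Levels.

Context {M : ZF}.
Implicit Types V E S L c e g h i j n x y u v a : M.

Lemma closed_of_connected V E S a : connected V E -> a ∈ V -> a ∈ S -> adj_closed E S ->
  subset V S.
Proof.
  intros HC Ha HaS Hc v Hv. destruct (HC a v Ha Hv) as [p Hp].
  apply is_path_iff in Hp. destruct Hp as [n [Hn [Hp [P0 [Pn Pa]]]]].
  assert (K : forall i, i ∈ omega -> i ∈ succ n -> ap p i ∈ S).
  { omega_induction; [definability| |].
    - intros _. rewrite P0. exact HaS.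
    - intros i Hi IH Hs. apply succ_mono_inv in Hs; auto.
      apply (Hc (ap p i)); auto. apply IH. apply in_succ; auto. }
  rewrite <- Pn. apply K; auto. apply in_succ; auto.
Qed.

Lemma infinite_inhabited V : ~ is_finite V -> exists a, a ∈ V.
Proof.
  intro H. apply not_empty_iff. intro K. apply is_empty_iff in K. subst V.
  exact (H finite_empty).
Qed.

(** Level [n] consists of the ends of the walks of length [n] from [a]; levels
    overlap, but unlike the spheres they satisfy a one-step recursion. *)
Definition is_levels V E a L : Prop :=
  is_fun L omega (power V) /\ ap L empty = sing a /\
  forall n v, n ∈ omega -> (v ∈ ap L (succ n) <-> v ∈ V /\ exists u, u ∈ ap L n /\ adj E u v).

Lemma levels_exist V E a : a ∈ V -> exists L, is_levels V E a L.
Proof.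
  intro Ha. set (nb := fun S => sep V (fun v => exists u, u ∈ S /\ adj E u v)).
  destruct (recursion (power V) (sing a) (fun S S' => S' = nb S)) as [L [HL [L0 LS]]].
  - unfold nb. definability.
  - apply in_power. intros u Hu. apply in_sing in Hu. subst; exact Ha.
  - intros S HS. exists (nb S). split; auto. apply in_power. intros u Hu.
    unfold nb in Hu. rewrite in_sep in Hu by definability. tauto.
  - congruence.
  - exists L. split; [exact HL|]. split; [exact L0|]. intros n v Hn. rewrite (LS n Hn).
    unfold nb. rewrite in_sep by definability. reflexivity.
Qed.

Section WithLevels.

Context (V E a L : M).
Context (HG : is_graph V E).
Context (HF : locally_finite V E).
Context (HC : connected V E).
Context (Ha : a ∈ V).
Context (HL : is_levels V E a L).

Lemma level_subset n : n ∈ omega -> subset (ap L n) V.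
Proof. intro Hn. apply in_power. apply (ap_in L omega (power V)); auto. apply HL. Qed.

Lemma level_finite n : n ∈ omega -> is_finite (ap L n).
Proof.
  destruct HL as [_ [L0 LS]]. revert n. omega_induction; [definability| |].
  - rewrite L0. apply finite_sing.
  - intros n Hn IH.
    destruct (finite_relation (fun u v => v ∈ V /\ adj E u v) (ap L n)) as [Y [HY K]]; auto.
    + definability.
    + intros u Hu. destruct (HF u) as [N [HN FN]].
      * apply (level_subset n); auto.
      * exists N. split; auto. intros v Hv. apply HN, Hv.
    + apply (finite_subset Y); auto. intros v Hv. apply LS in Hv; auto.
      destruct Hv as [Hv [u [Hu Huv]]]. apply (K u); auto.
Qed.

Lemma level_cover v : v ∈ V -> exists n, n ∈ omega /\ v ∈ ap L n.
Proof.
  destruct HL as [_ [L0 LS]]. intro Hv.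
  assert (K : subset V (sep V (fun v => exists n, n ∈ omega /\ v ∈ ap L n))).
  { apply (closed_of_connected V E _ a); auto.
    - rewrite in_sep by definability. split; auto. exists empty. rewrite L0, in_sing.
      split; [apply zero_in_omega|reflexivity].
    - intros u w Hu Huw. rewrite in_sep in * by definability. destruct Hu as [Hu [n [Hn K]]].
      assert (Hw : w ∈ V) by apply (adj_vertices V E u w HG Huw).
      split; auto. exists (succ n). split; [apply succ_in_omega, Hn|].
      apply LS; auto. split; eauto. }
  specialize (K v Hv). rewrite in_sep in K by definability. tauto.
Qed.

End WithLevels.

Lemma KL_vertices_embed V E : KL M -> is_graph V E -> ~ is_finite V -> locally_finite V E ->
  connected V E -> exists h, is_injection h V omega.
Proof.
  intros HK HG HI HF HC. destruct (infinite_inhabited V HI) as [a Ha].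
  destruct (levels_exist V E a Ha) as [L HL].
  apply (KL_countable_union L (power V)); auto.
  - apply HL.
  - intros i Hi. apply (level_finite V E a L); auto.
  - apply (level_cover V E a L); auto.
Qed.

Lemma edge_endpoints V E e : is_graph V E -> e ∈ E ->
  exists x y, x ∈ V /\ y ∈ V /\ x <> y /\ e = upair x y /\ adj E x y.
Proof.
  intros HG He. destruct (HG e He) as [x [y [Hx [Hy [Ne K]]]]]. apply is_upair_iff in K.
  subst e. exists x, y. rewrite adj_iff. auto 6.
Qed.

(** The edges meeting level [n] are subsets of the union of levels [n] and [n + 1]. *)
Lemma KL_edges_embed V E : KL M -> is_graph V E -> ~ is_finite V -> locally_finite V E ->
  connected V E -> exists h, is_injection h E omega.
Proof.
  intros HK HG HI HF HC. destruct (infinite_inhabited V HI) as [a Ha].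
  destruct (levels_exist V E a Ha) as [L HL].
  set (F := fun n => sep E (fun e => exists u, u ∈ e /\ u ∈ ap L n)).
  assert (InF : forall n e, e ∈ F n <-> e ∈ E /\ exists u, u ∈ e /\ u ∈ ap L n).
  { intros n e. unfold F. rewrite in_sep by definability. reflexivity. }
  assert (HT : definable_op (fun e : nat -> M => F (e 0))) by (unfold F; definability).
  assert (HE : forall n, n ∈ omega -> F n ∈ power E).
  { intros n Hn. apply in_power. intros e He. apply InF in He. tauto. }
  apply (KL_countable_union (lam omega (power E) F) (power E)); auto.
  - apply lam_is_fun; auto.
  - intros n Hn. rewrite ap_lam; auto.
    apply (finite_subset (power (cup (ap L n) (ap L (succ n))))).
    + apply finite_power, finite_cup; apply (level_finite V E a L); auto using succ_in_omega.
    + intros e He. apply InF in He. destruct He as [He [u [Hu HuL]]].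
      destruct (edge_endpoints V E e HG He) as [x [y [Hx [Hy [Ne [-> Hxy]]]]]].
      apply in_power. intros w Hw. apply in_cup.
      assert (Hw' : w ∈ V) by (apply in_upair in Hw; destruct Hw; subst; auto).
      destruct (classic (w = u)) as [->|Nw]; auto. right.
      destruct HL as [_ [_ LS]]. apply LS; auto. split; auto. exists u. split; auto.
      apply in_upair in Hw, Hu.
      destruct Hw as [->| ->], Hu as [->| ->]; auto using adj_sym; tauto.
  - intros e He. destruct (edge_endpoints V E e HG He) as [x [y [Hx [Hy [Ne [-> Hxy]]]]]].
    destruct (level_cover V E a L HG HC Ha HL x Hx) as [n [Hn Hl]].
    exists n. split; auto. rewrite ap_lam; auto. apply InF. split; auto.
    exists x. rewrite in_upair. auto.
Qed.

Lemma KL_imp_KL1 : KL M -> KL1 M.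
Proof.
  intros HK V E HG HI HF HC. destruct (KL_vertices_embed V E HK HG HI HF HC) as [h [Hf Hi]].
  exists omega, h. split; [apply omega_cardinal|]. split; [exact Hf|].
  intros g [[[Gf _] _] _] Hp x y Hxy.
  destruct (app_fun_dom _ _ _ _ _ Gf Hxy) as [Hx Hy].
  destruct (proj1 (proj2 Hf) x Hx) as [k Hk], (proj1 (proj2 Hf) y Hy) as [k' Hk'].
  pose proof (Hp x y k k' Hxy Hk Hk') as E1. subst k'. exact (Hi x y k Hk Hk').
Qed.

Lemma KL_imp_KL4 : KL M -> KL4 M.
Proof.
  intros HK V E HG HI HF HC. destruct (KL_vertices_embed V E HK HG HI HF HC) as [h [Hf Hi]].
  exists omega, h. split; [apply omega_cardinal|]. split; [exact Hf|].
  intros x y k k' Hxy Hk Hk' ->. apply (adj_vertices V E x y HG Hxy).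
  exact (Hi x y k' Hk Hk').
Qed.

Lemma KL_imp_KL3 : KL M -> KL3 M.
Proof.
  intros HK V E HG HI HF HC. destruct (KL_edges_embed V E HK HG HI HF HC) as [h [Hf Hi]].
  exists omega, h. split; [apply omega_cardinal|]. split; [exact Hf|].
  intros e e' x k k' Ne _ _ Hk Hk' ->. apply Ne. exact (Hi e e' k' Hk Hk').
Qed.

(** An automorphism that fixes every edge setwise and moves [x] must swap [x]
    with each of its neighbours.  Then [x] has at most one neighbour, which in
    turn has no neighbour but [x], so the graph has at most two vertices. *)
Lemma KL_imp_KL2 : KL M -> KL2 M.
Proof.
  intros HK V E HG HI HF HC. destruct (KL_edges_embed V E HK HG HI HF HC) as [h [Hf Hi]].
  exists omega, h. split; [apply omega_cardinal|]. split; [exact Hf|].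
  intros g [[[Gf _] _] Ga] Hp x x' Hxx'. apply NNPP. intro Ne.
  assert (Fix : forall u u' v v', app g u u' -> app g v v' -> adj E u v -> upair u v = upair u' v').
  { intros u u' v v' Hu Hv Huv. pose proof (proj1 (Ga _ _ _ _ Hu Hv) Huv) as Huv'.
    apply adj_iff in Huv, Huv'.
    destruct (proj1 (proj2 Hf) _ Huv) as [k Hk], (proj1 (proj2 Hf) _ Huv') as [k' Hk'].
    assert (k = k').
    { apply (Hp u v u' v' (upair u v) (upair u' v')); auto; apply is_upair_iff; auto. }
    subst k'. exact (Hi _ _ k Hk Hk'). }
  destruct (app_fun_dom _ _ _ _ _ Gf Hxx') as [Hx Hx'].
  assert (Nx : forall z, adj E x z -> z = x' /\ app g z x).
  { intros z Hz. destruct (adj_vertices V E x z HG Hz) as [_ [HzV _]].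
    destruct (proj1 (proj2 Gf) z HzV) as [z' Hz'].
    pose proof (upair_inj _ _ _ _ (Fix x x' z z' Hxx' Hz' Hz)) as [[K1 K2]|[K1 K2]].
    - destruct Ne; auto.
    - subst. auto. }
  assert (Nx' : forall z, app g x' x -> adj E x' z -> z = x).
  { intros z Hx'x Hz. destruct (adj_vertices V E x' z HG Hz) as [_ [HzV _]].
    destruct (proj1 (proj2 Gf) z HzV) as [z' Hz'].
    pose proof (upair_inj _ _ _ _ (Fix x' x z z' Hx'x Hz' Hz)) as [[K1 K2]|[K1 K2]]; auto.
    destruct Ne; auto. }
  apply HI.
  destruct (classic (exists z, adj E x z)) as [[z Hz]|N].
  - destruct (Nx z Hz) as [-> Hx'x].
    apply (finite_subset (upair x x')).
    + apply (finite_subset (cup (sing x) (sing x'))); [apply finite_cup; apply finite_sing|].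
      intros u. rewrite in_cup, in_upair, !in_sing. auto.
    + apply (closed_of_connected V E _ x); auto; [apply in_upair; auto|].
      intros u v Hu Huv. apply in_upair in Hu. apply in_upair. destruct Hu as [->| ->].
      * right. apply Nx, Huv.
      * left. apply Nx'; auto.
  - apply (finite_subset (sing x)); [apply finite_sing|].
    apply (closed_of_connected V E _ x); auto; [apply in_sing; auto|].
    intros u v Hu Huv. apply in_sing in Hu. subst. destruct N; eauto.
Qed.

End Levels.

(** * The graphs attached to a family of finite sets *)

Section Attached.

Context {M : ZF}.
Implicit Types V E S A z e i j x y u v a : M.

Section WithFamily.

Context (A z z' V E : M).
Context (HA : almost_acceptable omega A).
Context (HZ : admissible_enumerations A z z').
Context (HV : GH_vertices A z z' V).
Context (G_in_E : forall e, G_edge A z z' e -> e ∈ E).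
Context (E_in_H : forall e, e ∈ E -> H_edge A z z' e).

Lemma family_fun : exists B, is_fun A omega B.
Proof.
  destruct HA as [[[w [B [Hw HB]]] _] _]. apply is_omega_iff in Hw. subst. eauto.
Qed.

Lemma enum_fun : exists B, is_injection z omega B.
Proof. destruct HZ as [[w [B [Hw HB]]] _]. apply is_omega_iff in Hw. subst. eauto. Qed.

Lemma enum_fun' : exists B, is_injection z' omega B.
Proof. destruct HZ as [_ [[w [B [Hw HB]]] _]]. apply is_omega_iff in Hw. subst. eauto. Qed.

Lemma app_family i x : app A i x <-> i ∈ omega /\ x = ap A i.
Proof. destruct family_fun as [B HB]. apply (app_ap_iff A omega B); auto. Qed.

Lemma app_enum i x : app z i x <-> i ∈ omega /\ x = ap z i.
Proof. destruct enum_fun as [B HB]. apply (app_ap_iff z omega B). apply HB. Qed.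

Lemma app_enum' i x : app z' i x <-> i ∈ omega /\ x = ap z' i.
Proof. destruct enum_fun' as [B HB]. apply (app_ap_iff z' omega B). apply HB. Qed.

(** The vertices come in finite blocks, and every edge stays in a block or joins
    consecutive vertices of the backbone.  One notion of block serves both
    graphs, whose common properties follow from bounds on the edge set. *)
Definition block i x : Prop :=
  i ∈ omega /\ (x ∈ ap A i \/ x = ap z i \/ x = ap z' i).

Lemma vertex_iff x : x ∈ V <-> exists i, block i x.
Proof.
  rewrite (HV x). unfold in_Y, in_Z, block.
  setoid_rewrite app_family. setoid_rewrite app_enum. setoid_rewrite app_enum'.
  split.
  - intros [[i [a [[Hi ->] Hx]]]|[[i [Hi ->]]|[i [Hi ->]]]]; exists i; auto.
  - intros [i [Hi [Hx|[->| ->]]]]; eauto 8.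
Qed.

Lemma block_unique i j x : block i x -> block j x -> i = j.
Proof.
  destruct HZ as [_ [_ [D1 [D2 D3]]]]. destruct HA as [[_ [_ Dis]] _].
  destruct enum_fun as [B HB], enum_fun' as [B' HB'].
  apply injection_iff in HB, HB'. destruct HB as [_ Iz], HB' as [_ Iz'].
  assert (inY : forall k, k ∈ omega -> x ∈ ap A k -> in_Y A x).
  { intros k Hk Hx. exists k, (ap A k). rewrite app_family. auto. }
  assert (inZ : forall k, k ∈ omega -> x = ap z k -> in_Z z x).
  { intros k Hk Hx. exists k. rewrite app_enum. auto. }
  assert (inZ' : forall k, k ∈ omega -> x = ap z' k -> in_Z z' x).
  { intros k Hk Hx. exists k. rewrite app_enum'. auto. }
  intros [Hi Ci] [Hj Cj]. specialize (D1 x). specialize (D2 x). specialize (D3 x).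
  destruct Ci as [Ci|[Ci|Ci]], Cj as [Cj|[Cj|Cj]].
  - apply NNPP. intro Ne. apply (Dis i j (ap A i) (ap A j) Ne); [apply app_family..|]; eauto.
  - destruct D2; eauto.
  - destruct D3; eauto.
  - destruct D2; eauto.
  - apply Iz; congruence.
  - destruct D1; eauto.
  - destruct D3; eauto.
  - destruct D1; eauto.
  - apply Iz'; congruence.
Qed.

Lemma family_finite i : i ∈ omega -> is_finite (ap A i).
Proof.
  intro Hi. exists omega. split; [apply omega_spec|]. apply (proj2 HA i). apply app_family. auto.
Qed.

Lemma definable_block : definable (fun e : nat -> M => block (e 1) (e 0)).
Proof. unfold block. definability. Qed.

Lemma finite_blocks n : n ∈ omega ->
  exists Y, is_finite Y /\ forall i x, i ∈ n -> block i x -> x ∈ Y.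
Proof.
  intro Hn. apply finite_relation; [apply definable_block|apply finite_nat, Hn|].
  intros i Hi. exists (insert (ap z' i) (insert (ap z i) (ap A i))). split.
  - apply finite_insert, finite_insert, family_finite. exact (omega_trans n i Hn Hi).
  - intros x [_ Hx]. rewrite !in_insert. tauto.
Qed.

Lemma edge_zz i : i ∈ omega -> upair (ap z i) (ap z (succ i)) ∈ E.
Proof.
  intro Hi. apply G_in_E. left. exists i, (succ i), (ap z i), (ap z (succ i)).
  rewrite is_succ_iff, !app_enum, is_upair_iff. auto 10 using succ_in_omega.
Qed.

Lemma edge_zz' i : i ∈ omega -> upair (ap z i) (ap z' i) ∈ E.
Proof.
  intro Hi. apply G_in_E. right. left. exists i, (ap z i), (ap z' i).
  rewrite app_enum, app_enum', is_upair_iff. auto.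
Qed.

Lemma edge_az' i x : i ∈ omega -> x ∈ ap A i -> upair x (ap z' i) ∈ E.
Proof.
  intros Hi Hx. apply G_in_E. right. right. exists i, (ap A i), x, (ap z' i).
  rewrite app_family, app_enum', is_upair_iff. auto.
Qed.

Lemma edge_cases e : e ∈ E ->
  (exists i, i ∈ omega /\ e = upair (ap z i) (ap z (succ i))) \/
  (exists i x y, block i x /\ block i y /\ x <> y /\ e = upair x y).
Proof.
  intro He. destruct HZ as [_ [_ [D1 [D2 D3]]]].
  apply E_in_H in He. destruct He as [[H|[H|H]]|H].
  - destruct H as [i [j [x [y [Hj [Hx [Hy K]]]]]]]. left.
    apply is_succ_iff in Hj. apply is_upair_iff in K. apply app_enum in Hx, Hy.
    destruct Hx as [Hi ->], Hy as [_ ->]. subst. eauto.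
  - destruct H as [i [x [y [Hx [Hy K]]]]]. right. exists i, x, y. apply is_upair_iff in K.
    assert (x <> y) by (intros ->; apply (D1 y); split; eexists; eauto).
    apply app_enum in Hx. apply app_enum' in Hy. destruct Hx as [Hi ->], Hy as [_ ->].
    unfold block. auto 6.
  - destruct H as [i [a [x [y [Ha [Hx [Hy K]]]]]]]. right. exists i, x, y. apply is_upair_iff in K.
    assert (x <> y) by (intros ->; apply (D3 y); split; [exists i|exists i, a]; auto).
    apply app_family in Ha. apply app_enum' in Hy. destruct Ha as [Hi ->], Hy as [_ ->].
    unfold block. auto 6.
  - destruct H as [i [a [x [y [Ha [Hx [Hy [Ne K]]]]]]]]. right. exists i, x, y.
    apply is_upair_iff in K. apply app_family in Ha. destruct Ha as [Hi ->].
    unfold block. auto 6.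
Qed.

Lemma attached_graph : is_graph V E.
Proof.
  intros e He. destruct (edge_cases e He) as [[i [Hi ->]]|[i [x [y [Hx [Hy [Ne ->]]]]]]].
  - exists (ap z i), (ap z (succ i)). rewrite !vertex_iff, is_upair_iff.
    unfold block. repeat split; eauto 6 using succ_in_omega.
    destruct enum_fun as [B HB]. apply injection_iff in HB. destruct HB as [_ Iz].
    intro E1. apply Iz in E1; auto using succ_in_omega. apply (mem_irrefl i).
    rewrite E1 at 2. apply in_succ; auto.
  - exists x, y. rewrite !vertex_iff, is_upair_iff. eauto 6.
Qed.

Lemma attached_infinite : ~ is_finite V.
Proof.
  intro H. apply (@omega_infinite M). destruct enum_fun as [B HB]. apply injection_iff in HB.
  apply (finite_injection (lam omega V (ap z)) omega V); auto.
  apply lam_injection; [definability| |apply HB].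
  intros i Hi. apply vertex_iff. exists i. unfold block. auto.
Qed.

Lemma attached_locally_finite : locally_finite V E.
Proof.
  intros v Hv. exists (sep V (fun u => adj E v u)). split.
  - intro u. rewrite in_sep by definability. reflexivity.
  - apply vertex_iff in Hv. destruct Hv as [i Bv]. pose proof Bv as [Hi _].
    destruct (finite_blocks (succ (succ i))) as [Y [HY K]]; auto using succ_in_omega.
    apply (finite_subset Y); auto. intros u Hu. rewrite in_sep in Hu by definability.
    destruct Hu as [_ Hu]. apply adj_iff in Hu.
    assert (Bz : forall j, j ∈ omega -> block j (ap z j)) by (unfold block; auto).
    destruct (edge_cases _ Hu) as [[j [Hj Ee]]|[j [x [y [Hx [Hy [Ne Ee]]]]]]];
      apply upair_inj in Ee; destruct Ee as [[-> ->]|[-> ->]].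
    + apply (K (succ j)); auto using succ_in_omega.
      rewrite (block_unique i j (ap z j) Bv); auto. apply in_succ; auto.
    + apply (K j); auto. rewrite (block_unique i (succ j) (ap z (succ j)) Bv), !in_succ;
        auto using succ_in_omega.
    + apply (K j); auto. rewrite (block_unique i j x Bv), !in_succ; auto.
    + apply (K j); auto. rewrite (block_unique i j y Bv), !in_succ; auto.
Qed.

Lemma attached_connected : connected V E.
Proof.
  apply (connected_of_root V E (ap z empty)).
  - apply attached_graph.
  - apply vertex_iff. exists empty. unfold block. auto using zero_in_omega.
  - intros S H0 Hc.
    assert (Sz : forall i, i ∈ omega -> ap z i ∈ S).
    { omega_induction; [definability|exact H0|]. intros i Hi IH.
      apply (Hc (ap z i)); auto. apply adj_iff, edge_zz, Hi. }
    assert (Sz' : forall i, i ∈ omega -> ap z' i ∈ S).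
    { intros i Hi. apply (Hc (ap z i)); auto. apply adj_iff, edge_zz', Hi. }
    intros v Hv. apply vertex_iff in Hv. destruct Hv as [i [Hi [H|[->| ->]]]]; auto.
    apply (Hc (ap z' i)); auto. apply adj_sym, adj_iff, edge_az'; auto.
Qed.

End WithFamily.

Lemma graphs_to_G (P : M -> M -> Prop) : every_infinite_locally_finite_connected_graph P ->
  every_almost_aleph0_acceptable_graph (@is_G M) P.
Proof.
  intros H w A z z' V E Hw HA HZ [HV HE]. apply is_omega_iff in Hw. subst.
  assert (H1 : forall e, G_edge A z z' e -> e ∈ E) by (intros e He; apply HE, He).
  assert (H2 : forall e, e ∈ E -> H_edge A z z' e) by (intros e He; left; apply HE, He).
  apply H; eauto using attached_graph, attached_infinite, attached_locally_finite,
    attached_connected.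
Qed.

Lemma graphs_to_H (P : M -> M -> Prop) : every_infinite_locally_finite_connected_graph P ->
  every_almost_aleph0_acceptable_graph (@is_H M) P.
Proof.
  intros H w A z z' V E Hw HA HZ [HV HE]. apply is_omega_iff in Hw. subst.
  assert (H1 : forall e, G_edge A z z' e -> e ∈ E) by (intros e He; apply HE; left; exact He).
  assert (H2 : forall e, e ∈ E -> H_edge A z z' e) by (intros e He; apply HE, He).
  apply H; eauto using attached_graph, attached_infinite, attached_locally_finite,
    attached_connected.
Qed.

End Attached.

(** * Colourings of the attached graphs separate the finite sets *)

Section Separation.

Context {M : ZF}.
Implicit Types V E S A B c e g i j k x y u v p q a : M.

(** What every one of the colourings provides: the members of the family are
    well-ordered simultaneously by the colours of their elements. *)
Definition separable A : Prop :=
  exists k c Y, is_ordinal k /\ is_fun c Y k /\ (forall i, i ∈ omega -> subset (ap A i) Y) /\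
    forall i x y, i ∈ omega -> x ∈ ap A i -> y ∈ ap A i -> ap c x = ap c y -> x = y.

(** Otherwise [x ∈ {x} ∈ (x, y) ∈ x] would be a membership cycle. *)
Lemma pair_not_in x y : pair x y ∉ x.
Proof.
  intro H. set (p := pair x y) in *.
  assert (Hs : sing x ∈ p) by (unfold p, pair; apply in_upair; auto).
  destruct (@zf_foundation M (insert p (upair x (sing x)))) as [z [Hz K]].
  - exists p. apply in_insert. auto.
  - apply K. apply in_insert in Hz. rewrite in_upair in Hz.
    setoid_rewrite in_insert. setoid_rewrite in_upair.
    destruct Hz as [[->| ->]| ->].
    + exists p. auto.
    + exists x. rewrite in_sing. auto.
    + exists (sing x). auto.
Qed.

Hint Unfold in_Y in_Z G_edge H_edge : defs.

(** Pairs whose first component is the union [U] of the range of [A] lie outside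
    [U]; a second component tells the two enumerations apart. *)
Lemma attached_exists A : almost_acceptable omega A -> exists z z' V,
  admissible_enumerations A z z' /\ GH_vertices A z z' V /\
  (exists E, forall e, e ∈ E <-> G_edge A z z' e) /\
  (exists E, forall e, e ∈ E <-> H_edge A z z' e).
Proof.
  intros [[[w [B [Hw HA]]] _] _]. apply is_omega_iff in Hw. subst w.
  set (U := union B).
  set (W := prod (sing U) (prod (upair empty (sing empty)) omega)).
  set (F := fun b i => pair U (pair b i)).
  assert (N0 : @empty M <> sing empty).
  { intro H. apply (proj1 (in_empty (@empty M))). rewrite H at 2. apply in_sing; auto. }
  assert (HW : forall b, b ∈ upair empty (sing empty) -> forall i, i ∈ omega -> F b i ∈ W).
  { intros b Hb i Hi. unfold W, F. rewrite !pair_in_prod, in_sing. auto. }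
  assert (HT : forall b, definable_op (fun e : nat -> M => F b (e 0))).
  { intro b. unfold F. definability. }
  assert (I0 : empty ∈ upair (@empty M) (sing empty)) by (apply in_upair; auto).
  assert (I1 : sing empty ∈ upair (@empty M) (sing empty)) by (apply in_upair; auto).
  assert (Inj : forall b, b ∈ upair empty (sing empty) -> is_injection (lam omega W (F b)) omega W).
  { intros b Hb. apply lam_injection; auto. intros i j _ _ H.
    apply pair_inj in H. destruct H as [_ H]. apply pair_inj in H. tauto. }
  assert (Val : forall b x, b ∈ upair empty (sing empty) -> in_Z (lam omega W (F b)) x ->
            exists i, x = F b i).
  { intros b x Hb [i Hi]. apply (app_ap_iff _ omega W) in Hi; [|apply Inj, Hb].
    destruct Hi as [Hi ->]. rewrite ap_lam; eauto. }
  assert (InU : forall x, in_Y A x -> x ∈ U).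
  { intros x [i [a [Ha Hx]]]. apply in_union. exists a. split; auto.
    apply (app_fun_dom A omega B i a HA Ha). }
  set (z := lam omega W (F empty)). set (z' := lam omega W (F (sing empty))).
  assert (InW : forall x, in_Z z x \/ in_Z z' x -> x ∈ W).
  { intros x [[i Hi]|[i Hi]]; refine (proj2 (app_fun_dom _ omega W i x _ Hi)); apply Inj; auto. }
  assert (HV : GH_vertices A z z' (sep (cup U W) (fun x => in_Y A x \/ in_Z z x \/ in_Z z' x))).
  { intro x. rewrite in_sep by definability. rewrite in_cup. split; [tauto|].
    intros H. split; auto. destruct H as [H|H]; auto. }
  exists z, z', (sep (cup U W) (fun x => in_Y A x \/ in_Z z x \/ in_Z z' x)).
  split; [|split; [exact HV|]].
  - split; [|split; [|split; [|split]]].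
    + exists omega, W. split; [apply omega_spec|apply Inj, I0].
    + exists omega, W. split; [apply omega_spec|apply Inj, I1].
    + intros x [H H']. apply Val in H, H'; auto. destruct H as [i ->], H' as [j H].
      apply pair_inj in H. destruct H as [_ H]. apply pair_inj in H. tauto.
    + intros x [H H']. apply Val in H; auto. destruct H as [i ->].
      exact (pair_not_in _ _ (InU _ H')).
    + intros x [H H']. apply Val in H; auto. destruct H as [i ->].
      exact (pair_not_in _ _ (InU _ H')).
  - set (V := sep (cup U W) (fun x => in_Y A x \/ in_Z z x \/ in_Z z' x)) in *.
    assert (EV : forall e x y, (in_Y A x \/ in_Z z x \/ in_Z z' x) ->
       (in_Y A y \/ in_Z z y \/ in_Z z' y) -> is_upair e x y -> e ∈ power V).
    { intros e x y Hx Hy He. apply is_upair_iff in He. subst e. apply in_power.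
      intros u Hu. apply in_upair in Hu. apply HV. destruct Hu; subst; auto. }
    assert (EG : forall e, G_edge A z z' e -> e ∈ power V).
    { intros e [H|[H|H]].
      - destruct H as [i [j [x [y [_ [Hx [Hy He]]]]]]]. apply (EV e x y); auto;
          right; left; [exists i|exists j]; auto.
      - destruct H as [i [x [y [Hx [Hy He]]]]]. apply (EV e x y); auto; right;
          [left|right]; exists i; auto.
      - destruct H as [i [a [x [y [Ha [Hx [Hy He]]]]]]]. apply (EV e x y); auto.
        + left. exists i, a. auto.
        + right. right. exists i. auto. }
    assert (EH : forall e, H_edge A z z' e -> e ∈ power V).
    { intros e [H|H]; auto. destruct H as [i [a [x [y [Ha [Hx [Hy [_ He]]]]]]]].
      apply (EV e x y); auto; left; exists i, a; auto. }
    split; [exists (sep (power V) (fun e => G_edge A z z' e))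
           |exists (sep (power V) (fun e => H_edge A z z' e))];
      intro e; rewrite in_sep by definability; split; try tauto; auto.
Qed.

(** A transposition, as a relation because its graph is what is needed to form it
    inside the model. *)
Definition swaps x y u v : Prop :=
  (u = x /\ v = y) \/ (u = y /\ v = x) \/ (u <> x /\ u <> y /\ v = u).

Hint Unfold swaps : defs.

Lemma swaps_sym x y u v : swaps x y u v -> swaps x y v u.
Proof. unfold swaps. intuition (subst; auto). Qed.

Lemma swaps_fun x y u v v' : swaps x y u v -> swaps x y u v' -> v = v'.
Proof. unfold swaps. intuition congruence. Qed.

Lemma swaps_total x y u : exists v, swaps x y u v.
Proof.
  unfold swaps. destruct (classic (u = x)); [eauto|]. destruct (classic (u = y)); [eauto|]. eauto 6.
Qed.

Lemma swaps_fixed x y u v : u <> x -> u <> y -> swaps x y u v -> v = u.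
Proof. unfold swaps. tauto. Qed.

Section WithFamily.

Context (A z z' V : M).
Context (HA : almost_acceptable omega A).
Context (HZ : admissible_enumerations A z z').
Context (HV : GH_vertices A z z' V).

(** The edges of the first graph with a preferred orientation, which removes the
    symmetric cases from the verification that a transposition preserves them. *)
Definition arc p q : Prop := exists i, i ∈ omega /\
  ((p = ap z i /\ q = ap z (succ i)) \/ (p = ap z i /\ q = ap z' i) \/
   (p ∈ ap A i /\ q = ap z' i)).

Lemma G_edge_arc e : G_edge A z z' e <-> exists p q, arc p q /\ e = upair p q.
Proof.
  unfold G_edge, arc. setoid_rewrite is_succ_iff. setoid_rewrite is_upair_iff.
  split.
  - intros [H|[H|H]].
    + destruct H as [i [j [p [q [-> [Hp [Hq ->]]]]]]]. rewrite (app_enum A z z' HZ) in Hp, Hq.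
      destruct Hp, Hq. exists p, q. split; [exists i; auto|auto].
    + destruct H as [i [p [q [Hp [Hq ->]]]]]. rewrite (app_enum A z z' HZ) in Hp.
      rewrite (app_enum' A z z' HZ) in Hq. destruct Hp, Hq. exists p, q. split; [exists i; auto|auto].
    + destruct H as [i [a [p [q [Ha [Hp [Hq ->]]]]]]]. rewrite (app_family A HA) in Ha.
      rewrite (app_enum' A z z' HZ) in Hq. destruct Ha as [Hi ->], Hq. exists p, q.
      split; [exists i|]; auto.
  - intros [p [q [[i [Hi [[Hp Hq]|[[Hp Hq]|[Hp Hq]]]]] ->]]].
    + left. exists i, (succ i), p, q. rewrite !(app_enum A z z' HZ). auto 10 using succ_in_omega.
    + right. left. exists i, p, q. rewrite (app_enum A z z' HZ), (app_enum' A z z' HZ). auto 6.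
    + right. right. exists i, (ap A i), p, q. rewrite (app_family A HA), (app_enum' A z z' HZ).
      auto 6.
Qed.

Section Swap.

Context (i x y : M).
Context (Hi : i ∈ omega).
Context (Hx : x ∈ ap A i).
Context (Hy : y ∈ ap A i).

Lemma enum_not_in_family j u : j ∈ omega -> u ∈ ap A i -> ap z j <> u /\ ap z' j <> u.
Proof.
  intros Hj Hu. destruct HZ as [_ [_ [_ [D2 D3]]]].
  assert (K : in_Y A u) by (exists i, (ap A i); rewrite (app_family A HA); auto).
  split; intro E.
  - apply (D2 u). split; auto. exists j. rewrite (app_enum A z z' HZ). auto.
  - apply (D3 u). split; auto. exists j. rewrite (app_enum' A z z' HZ). auto.
Qed.

Lemma swaps_enum j u : j ∈ omega -> swaps x y (ap z j) u -> u = ap z j.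
Proof. intros Hj. apply swaps_fixed; apply enum_not_in_family; auto. Qed.

Lemma swaps_enum' j u : j ∈ omega -> swaps x y (ap z' j) u -> u = ap z' j.
Proof. intros Hj. apply swaps_fixed; apply enum_not_in_family; auto. Qed.

Lemma family_index j u : j ∈ omega -> u ∈ ap A i -> u ∈ ap A j -> i = j.
Proof. intros Hj Hu Hu'. apply (block_unique A z z' HA HZ i j u); split; auto. Qed.

Lemma swaps_family j u v : j ∈ omega -> u ∈ ap A j -> swaps x y u v -> v ∈ ap A j.
Proof.
  intros Hj Hu [[-> ->]|[[-> ->]|[_ [_ ->]]]]; auto.
  - rewrite <- (family_index j x); auto.
  - rewrite <- (family_index j y); auto.
Qed.

Lemma swaps_arc p q p' q' : arc p q -> swaps x y p p' -> swaps x y q q' -> arc p' q'.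
Proof.
  intros [j [Hj H]] Hp Hq. exists j. split; [exact Hj|].
  destruct H as [[-> ->]|[[-> ->]|[K ->]]].
  - apply swaps_enum in Hp; auto. apply swaps_enum in Hq; auto using succ_in_omega.
  - apply swaps_enum in Hp; auto. apply swaps_enum' in Hq; auto.
  - apply swaps_enum' in Hq; auto. pose proof (swaps_family j p p' Hj K Hp). auto.
Qed.

(** Elements of one member of the family have the same single neighbour. *)
Lemma swap_automorphism E : (forall e, e ∈ E <-> G_edge A z z' e) ->
  exists g, is_automorphism V E g /\
    forall u v, app g u v <-> u ∈ V /\ v ∈ V /\ swaps x y u v.
Proof.
  intro HE.
  assert (HD : definable (fun e : nat -> M => swaps x y (e 1) (e 0))) by definability.
  pose proof (fun u v => app_graph V V (swaps x y) u v HD) as K.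
  assert (InV : forall u, u ∈ ap A i -> u ∈ V).
  { intros u Hu. apply HV. left. exists i, (ap A i). rewrite (app_family A HA). auto. }
  assert (VV : forall u v, u ∈ V -> swaps x y u v -> v ∈ V).
  { intros u v Hu [[-> ->]|[[-> ->]|[_ [_ ->]]]]; auto. }
  assert (G : is_fun (graph V V (swaps x y)) V V).
  { apply graph_is_fun; auto.
    - intros u Hu. destruct (swaps_total x y u) as [v Hv]. eauto.
    - intros u v v' _ _ _. apply swaps_fun. }
  assert (Adj : forall u v u' v', adj E u v -> swaps x y u u' -> swaps x y v v' -> adj E u' v').
  { intros u v u' v' H Hu Hv. apply adj_iff in H. apply HE, G_edge_arc in H.
    destruct H as [p [q [Hpq H]]]. apply adj_iff, HE, G_edge_arc.
    apply upair_inj in H. destruct H as [[-> ->]|[-> ->]].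
    - exists u', v'. split; auto. exact (swaps_arc p q u' v' Hpq Hu Hv).
    - exists v', u'. split; [exact (swaps_arc p q v' u' Hpq Hv Hu)|apply upair_comm]. }
  exists (graph V V (swaps x y)). split; [split; [split; [split|]|]|exact K].
  - exact G.
  - intros u u' v H H'. apply K in H, H'. apply (swaps_fun x y v); apply swaps_sym; tauto.
  - intros v Hv. destruct (swaps_total x y v) as [u Hu]. exists u. apply K.
    split; [eapply VV; eauto|]. split; auto. apply swaps_sym, Hu.
  - intros u v u' v' H H'. apply K in H, H'. destruct H as [_ [_ H]], H' as [_ [_ H']].
    split; intro L.
    + exact (Adj u v u' v' L H H').
    + exact (Adj u' v' u v L (swaps_sym _ _ _ _ H) (swaps_sym _ _ _ _ H')).
Qed.

End Swap.

Lemma family_vertex i u : i ∈ omega -> u ∈ ap A i -> u ∈ V.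
Proof.
  intros Hi Hu. apply HV. left. exists i, (ap A i). rewrite (app_family A HA). auto.
Qed.

(** If two elements of one member had the same colour, their transposition would
    be a nontrivial automorphism preserving the colouring. *)
Lemma separable_of_distinguishing_number E : (forall e, e ∈ E <-> G_edge A z z' e) ->
  has_distinguishing_number V E -> separable A.
Proof.
  intros HE [k [c [[Hk _] [Hc Hd]]]]. exists k, c, V. split; [exact Hk|]. split; [exact Hc|].
  split; [intros i Hi u; apply family_vertex, Hi|]. intros i x y Hi Hx Hy Exy.
  destruct (swap_automorphism i x y Hi Hx Hy E HE) as [g [Ag Kg]].
  apply (Hd g Ag).
  - intros u u' m m' Hu Hm Hm'. apply Kg in Hu. destruct Hu as [_ [_ Hu]].
    rewrite <- (ap_eq _ _ _ _ _ Hc Hm), <- (ap_eq _ _ _ _ _ Hc Hm').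
    destruct Hu as [[-> ->]|[[-> ->]|[_ [_ ->]]]]; auto.
  - apply Kg. split; [apply (family_vertex i); auto|]. split; [apply (family_vertex i); auto|].
    left. auto.
Qed.

(** An element is given the colour of its edge to the backbone. *)
Lemma separable_of_edge_colours E c k : is_ordinal k -> is_fun c E k ->
  (forall i u, i ∈ omega -> u ∈ ap A i -> upair u (ap z' i) ∈ E) ->
  (forall i x y, i ∈ omega -> x ∈ ap A i -> y ∈ ap A i ->
     ap c (upair x (ap z' i)) = ap c (upair y (ap z' i)) -> x = y) -> separable A.
Proof.
  intros Hk Hc HE Hinj.
  set (Y := sep V (fun x => exists i, i ∈ omega /\ x ∈ ap A i)).
  assert (InY : forall x, x ∈ Y <-> x ∈ V /\ exists i, i ∈ omega /\ x ∈ ap A i).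
  { intro x. unfold Y. rewrite in_sep by definability. reflexivity. }
  set (R := fun x v => exists i, i ∈ omega /\ x ∈ ap A i /\ v = ap c (upair x (ap z' i))).
  assert (HR : definable (fun e : nat -> M => R (e 1) (e 0))) by (unfold R; definability).
  assert (Rk : forall i x, i ∈ omega -> x ∈ ap A i -> ap c (upair x (ap z' i)) ∈ k).
  { intros i x Hi Hx. apply (ap_in c E k); auto. }
  assert (G : is_fun (graph Y k R) Y k).
  { apply graph_is_fun; auto.
    - intros x Hx. apply InY in Hx. destruct Hx as [_ [i [Hi Hx]]].
      exists (ap c (upair x (ap z' i))). split; auto. exists i. auto.
    - intros x v v' _ _ _ [i [Hi [Xi ->]]] [j [Hj [Xj ->]]].
      rewrite (family_index i Hi j x); auto. }
  assert (YA : forall i x, i ∈ omega -> x ∈ ap A i -> x ∈ Y).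
  { intros i x Hi Hx. apply InY. split; eauto using family_vertex. }
  assert (Ap : forall i x, i ∈ omega -> x ∈ ap A i ->
            ap (graph Y k R) x = ap c (upair x (ap z' i))).
  { intros i x Hi Hx. apply ap_graph; eauto. exists i. auto. }
  exists k, (graph Y k R), Y. split; [exact Hk|]. split; [exact G|].
  split; [intros i Hi x; apply YA, Hi|]. intros i x y Hi Hx Hy. rewrite !(Ap i) by assumption.
  apply Hinj; auto.
Qed.

Lemma G_edge_family i u : i ∈ omega -> u ∈ ap A i -> G_edge A z z' (upair u (ap z' i)).
Proof.
  intros Hi Hu. apply G_edge_arc. exists u, (ap z' i). split; auto. exists i. auto.
Qed.

(** The transposition of two elements moves only their edges to the backbone. *)
Lemma separable_of_distinguishing_index E : (forall e, e ∈ E <-> G_edge A z z' e) ->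
  has_distinguishing_index V E -> separable A.
Proof.
  intros HE [k [c [[Hk _] [Hc Hd]]]].
  apply (separable_of_edge_colours E c k); auto.
  { intros i u Hi Hu. apply HE, G_edge_family; auto. }
  intros i x y Hi Hx Hy Exy.
  destruct (swap_automorphism i x y Hi Hx Hy E HE) as [g [Ag Kg]].
  apply (Hd g Ag).
  - assert (Col : forall p q p' q', arc p q -> swaps x y p p' -> swaps x y q q' ->
                    ap c (upair p q) = ap c (upair p' q')).
    { intros p q p' q' [j [Hj H]] Hp Hq. destruct H as [[-> ->]|[[-> ->]|[K ->]]].
      - apply (swaps_enum i x y Hi Hx Hy) in Hp, Hq; auto using succ_in_omega. subst. auto.
      - apply (swaps_enum i x y Hi Hx Hy) in Hp; auto.
        apply (swaps_enum' i x y Hi Hx Hy) in Hq; auto. subst. auto.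
      - apply (swaps_enum' i x y Hi Hx Hy) in Hq; auto. subst q'.
        destruct Hp as [[-> ->]|[[-> ->]|[_ [_ ->]]]]; auto.
        + rewrite <- (family_index i Hi j x); auto.
        + rewrite <- (family_index i Hi j y); auto. }
    intros u v u' v' e e' m m' Hu Hv He He' Hm Hm'. apply Kg in Hu, Hv.
    destruct Hu as [_ [_ Hu]], Hv as [_ [_ Hv]]. apply is_upair_iff in He, He'. subst e e'.
    pose proof (proj1 (app_fun_dom _ _ _ _ _ Hc Hm)) as L.
    rewrite <- (ap_eq _ _ _ _ _ Hc Hm), <- (ap_eq _ _ _ _ _ Hc Hm').
    apply HE, G_edge_arc in L. destruct L as [p [q [Hpq L]]]. apply upair_inj in L.
    destruct L as [[-> ->]|[-> ->]]; auto.
    rewrite (upair_comm q p), (upair_comm u' v'). auto.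
  - apply Kg. split; [apply (family_vertex i); auto|]. split; [apply (family_vertex i); auto|].
    left. auto.
Qed.

Lemma separable_of_chromatic_index E : (forall e, e ∈ E <-> G_edge A z z' e) ->
  has_chromatic_index V E -> separable A.
Proof.
  intros HE [k [c [[Hk _] [Hc Hd]]]].
  assert (InE : forall i u, i ∈ omega -> u ∈ ap A i -> upair u (ap z' i) ∈ E).
  { intros i u Hi Hu. apply HE, G_edge_family; auto. }
  apply (separable_of_edge_colours E c k); auto.
  intros i x y Hi Hx Hy Exy. apply NNPP. intro Ne.
  apply (Hd (upair x (ap z' i)) (upair y (ap z' i)) (ap z' i)
            (ap c (upair x (ap z' i))) (ap c (upair y (ap z' i)))); auto.
  - intro K. apply upair_inj in K. destruct K as [[K _]|[K K']]; auto. congruence.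
  - apply in_upair; auto.
  - apply in_upair; auto.
  - apply (app_ap c E k); auto.
  - apply (app_ap c E k); auto.
Qed.

Lemma separable_of_chromatic_number E : (forall e, e ∈ E <-> H_edge A z z' e) ->
  has_chromatic_number V E -> separable A.
Proof.
  intros HE [k [c [[Hk _] [Hc Hd]]]]. exists k, c, V. split; [exact Hk|]. split; [exact Hc|].
  split; [intros i Hi u; apply family_vertex, Hi|].
  intros i x y Hi Hx Hy Exy. apply NNPP. intro Ne.
  apply (Hd x y (ap c x) (ap c y)); auto.
  - apply adj_iff, HE. right. exists i, (ap A i), x, y.
    rewrite (app_family A HA), is_upair_iff. auto 6.
  - apply (app_ap c V k); auto. apply (family_vertex i); auto.
  - apply (app_ap c V k); auto. apply (family_vertex i); auto.
Qed.

End WithFamily.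

Definition all_separable : Prop := forall A, almost_acceptable omega A -> separable A.

Lemma KL5_imp_separable : KL5 M -> all_separable.
Proof.
  intros H A HA. destruct (attached_exists A HA) as [z [z' [V [HZ [HV [[E HE] _]]]]]].
  apply (separable_of_distinguishing_number A z z' V HA HZ HV E HE).
  apply (H omega A z z' V E); auto using omega_spec. split; auto.
Qed.

Lemma KL6_imp_separable : KL6 M -> all_separable.
Proof.
  intros H A HA. destruct (attached_exists A HA) as [z [z' [V [HZ [HV [[E HE] _]]]]]].
  apply (separable_of_distinguishing_index A z z' V HA HZ HV E HE).
  apply (H omega A z z' V E); auto using omega_spec. split; auto.
Qed.

Lemma KL7_imp_separable : KL7 M -> all_separable.
Proof.
  intros H A HA. destruct (attached_exists A HA) as [z [z' [V [HZ [HV [[E HE] _]]]]]].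
  apply (separable_of_chromatic_index A z z' V HA HZ HV E HE).
  apply (H omega A z z' V E); auto using omega_spec. split; auto.
Qed.

Lemma KL8_imp_separable : KL8 M -> all_separable.
Proof.
  intros H A HA. destruct (attached_exists A HA) as [z [z' [V [HZ [HV [_ [E HE]]]]]]].
  apply (separable_of_chromatic_number A z z' V HA HV E HE).
  apply (H omega A z z' V E); auto using omega_spec. split; auto.
Qed.

End Separation.

(** * From separable spheres to a ray *)

Section Koenig.

Context {M : ZF}.
Implicit Types V E S L c k n m i u v w p q a r : M.

Section WithGraph.

Context (V E a L : M).
Context (HG : is_graph V E).
Context (HI : ~ is_finite V).
Context (HF : locally_finite V E).
Context (HC : connected V E).
Context (Ha : a ∈ V).
Context (HL : is_levels V E a L).

(** Distance exactly [n] from [a].  Unlike the levels, the spheres are disjoint. *)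
Definition sphere n : M := sep V (fun v => v ∈ ap L n /\ forall m, m ∈ n -> v ∉ ap L m).

Lemma in_sphere n v : v ∈ sphere n <-> v ∈ V /\ v ∈ ap L n /\ forall m, m ∈ n -> v ∉ ap L m.
Proof. apply (in_sep V (fun v => v ∈ ap L n /\ forall m, m ∈ n -> v ∉ ap L m)). definability. Qed.

Lemma op_sphere : definable_op (fun e : nat -> M => sphere (e 0)).
Proof. unfold sphere. definability. Qed.

Lemma sphere_exists v : v ∈ V -> exists n, n ∈ omega /\ v ∈ sphere n.
Proof.
  intro Hv. destruct (least_nat (fun n => v ∈ ap L n)) as [n [Hn K]].
  - definability.
  - apply (level_cover V E a L); auto.
  - exists n. rewrite in_sphere. tauto.
Qed.

Lemma sphere_unique n m v : n ∈ omega -> m ∈ omega -> v ∈ sphere n -> v ∈ sphere m -> n = m.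
Proof.
  rewrite !in_sphere. intros Hn Hm [_ [Hv K]] [_ [Hv' K']].
  destruct (nat_tricho n m Hn Hm) as [C|[C|C]]; auto.
  - destruct (K' n C Hv).
  - destruct (K m C Hv').
Qed.

Lemma sphere_zero v : v ∈ sphere empty <-> v = a.
Proof.
  rewrite in_sphere. destruct HL as [_ [L0 _]]. rewrite L0, in_sing. split; [tauto|].
  intros ->. repeat split; auto. intros m Hm. apply in_empty in Hm. tauto.
Qed.

Lemma sphere_parent n v : n ∈ omega -> v ∈ sphere (succ n) ->
  exists u, u ∈ sphere n /\ adj E u v.
Proof.
  destruct HL as [_ [_ LS]]. rewrite in_sphere. intros Hn [Hv [Hl K]]. apply LS in Hl; auto.
  destruct Hl as [_ [u [Hu Huv]]]. exists u. split; auto. apply in_sphere.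
  split; [apply (adj_vertices V E u v HG Huv)|]. split; auto. intros m Hm Hum.
  apply (K (succ m)); [apply succ_mono; auto|].
  apply LS; [exact (omega_trans n m Hn Hm)|]. eauto.
Qed.

(** If sphere [n] were empty, nothing beyond the levels below [n] could be reached,
    and these form a finite set. *)
Lemma sphere_nonempty n : n ∈ omega -> exists v, v ∈ sphere n.
Proof.
  intro Hn. destruct (zero_or_pos n Hn) as [->|Pn]; [exists a; apply sphere_zero; auto|].
  apply NNPP. intro N. apply HI.
  destruct (finite_relation (fun m v => v ∈ ap L m) n) as [Y [HY K]].
  - definability.
  - apply finite_nat, Hn.
  - intros m Hm. exists (ap L m). split; auto.
    apply (level_finite V E a L); auto. exact (omega_trans n m Hn Hm).
  - assert (Sub : subset V (sep V (fun v => exists m, m ∈ n /\ v ∈ ap L m))).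
    { destruct HL as [_ [L0 LS]]. apply (closed_of_connected V E _ a); auto.
      - rewrite in_sep by definability. split; auto. exists empty. rewrite L0, in_sing. auto.
      - intros u v Hu Huv. rewrite in_sep in * by definability. destruct Hu as [_ [m [Hm Hu]]].
        assert (Hv : v ∈ V) by apply (adj_vertices V E u v HG Huv). split; auto.
        assert (Hvm : v ∈ ap L (succ m)).
        { apply LS; [exact (omega_trans n m Hn Hm)|]. eauto. }
        destruct (succ_le n m Hn Hm) as [<-|C]; [|eauto].
        apply NNPP. intro N'. apply N. exists v. apply in_sphere. repeat split; auto.
        intros j Hj Hvj. apply N'. eauto. }
    apply (finite_subset Y); auto. intros v Hv. specialize (Sub v Hv).
    rewrite in_sep in Sub by definability. destruct Sub as [_ [m [Hm Hvm]]]. eauto.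
Qed.

Definition spheres : M := lam omega (power V) sphere.

Lemma ap_spheres n : n ∈ omega -> ap spheres n = sphere n.
Proof.
  apply ap_lam; [apply op_sphere|]. intros m _. apply in_power. intros v Hv.
  apply in_sphere in Hv. tauto.
Qed.

Lemma spheres_fun : is_fun spheres omega (power V).
Proof.
  apply lam_is_fun; [apply op_sphere|]. intros m _. apply in_power. intros v Hv.
  apply in_sphere in Hv. tauto.
Qed.

Lemma spheres_almost_acceptable : almost_acceptable omega spheres.
Proof.
  pose proof spheres_fun as G.
  assert (K : forall i x, app spheres i x -> i ∈ omega /\ x = sphere i).
  { intros i x H. apply (app_ap_iff _ _ _ _ _ G) in H. destruct H as [Hi ->].
    rewrite ap_spheres; auto. }
  split; [split; [|split]|].
  - exists omega, (power V). split; [apply omega_spec|exact G].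
  - intros i x H. apply K in H. destruct H as [Hi ->]. apply not_empty_iff, sphere_nonempty, Hi.
  - intros i j x y Ne Hx Hy [v [Hv Hv']]. apply K in Hx, Hy.
    destruct Hx as [Hi ->], Hy as [Hj ->]. apply Ne. exact (sphere_unique i j v Hi Hj Hv Hv').
  - intros i x H. apply K in H. destruct H as [Hi ->].
    assert (Fin : is_finite (sphere i)).
    { apply (finite_subset (ap L i)); [apply (level_finite V E a L); auto|].
      intros v Hv. apply in_sphere in Hv. tauto. }
    apply finite_iff in Fin. exact Fin.
Qed.

Definition child u v : Prop :=
  adj E u v /\ exists n, n ∈ omega /\ u ∈ sphere n /\ v ∈ sphere (succ n).

(** The least set containing [u] and closed under [child]: the vertices having [u]
    on some geodesic from [a].  No spanning tree has to be chosen. *)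
Definition descendants u : M :=
  sep V (fun w => forall S, u ∈ S -> (forall p q, p ∈ S -> child p q -> q ∈ S) -> w ∈ S).

Hint Unfold sphere child descendants : defs.

Lemma in_descendants u w : w ∈ descendants u <-> w ∈ V /\
  forall S, u ∈ S -> (forall p q, p ∈ S -> child p q -> q ∈ S) -> w ∈ S.
Proof.
  apply (in_sep V (fun w => forall S, u ∈ S ->
    (forall p q, p ∈ S -> child p q -> q ∈ S) -> w ∈ S)). definability.
Qed.

Lemma descendants_refl u : u ∈ V -> u ∈ descendants u.
Proof. intro Hu. apply in_descendants. auto. Qed.

Lemma descendants_child u p q : p ∈ descendants u -> child p q -> q ∈ descendants u.
Proof.
  rewrite !in_descendants. intros [Hp K] Hpq. split.
  - apply (adj_vertices V E p q HG), Hpq.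
  - intros S Hu HS. apply (HS p q); auto.
Qed.

Definition fertile u : Prop := u ∈ V /\ ~ is_finite (descendants u).

Hint Unfold fertile : defs.

(** Every vertex descends from [a], by induction on its distance. *)
Lemma fertile_root : fertile a.
Proof.
  split; [exact Ha|]. intro H. apply HI. apply (finite_subset (descendants a)); auto.
  assert (K : forall n, n ∈ omega -> forall v, v ∈ sphere n -> v ∈ descendants a).
  { omega_induction; [definability| |].
    - intros v Hv. apply sphere_zero in Hv. subst. apply descendants_refl, Ha.
    - intros n Hn IH v Hv. destruct (sphere_parent n v Hn Hv) as [u [Hu Huv]].
      apply (descendants_child a u v); auto. split; eauto. }
  intros v Hv. destruct (sphere_exists v Hv) as [n [Hn Hvn]]. eauto.
Qed.

(** The descendants of [u] are [u] and those of its finitely many children. *)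
Lemma fertile_child u : fertile u -> exists v, child u v /\ fertile v.
Proof.
  intros [Hu Inf]. apply NNPP. intro N. apply Inf.
  destruct (HF u Hu) as [Nb [HN FN]].
  destruct (finite_relation (fun v w => child u v /\ w ∈ descendants v) Nb) as [Y [HY K]]; auto.
  - definability.
  - intros v Hv. destruct (classic (child u v)) as [Hc|Hc].
    + exists (descendants v). split; [|tauto]. apply NNPP. intro N'. apply N. exists v.
      split; auto. split; auto. apply HN in Hv. tauto.
    + exists empty. split; [apply finite_empty|tauto].
  - apply (finite_subset (insert u Y)); [apply finite_insert, HY|].
    assert (HC' : forall v, child u v -> v ∈ Nb).
    { intros v Hv. apply HN. split; [|apply Hv]. apply (adj_vertices V E u v HG), Hv. }
    intros w Hw. apply in_descendants in Hw. destruct Hw as [_ Hw].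
    assert (HD : definable (fun e : nat -> M =>
      e 0 = u \/ exists v, child u v /\ e 0 ∈ descendants v)) by definability.
    specialize (Hw (sep V (fun w => w = u \/ exists v, child u v /\ w ∈ descendants v))).
    rewrite !in_sep in Hw by exact HD.
    destruct Hw as [_ Hw].
    + auto.
    + intros p q Hp Hpq. rewrite in_sep in * by exact HD.
      assert (Hq : q ∈ V) by (apply (adj_vertices V E p q HG), Hpq).
      split; auto. right. destruct Hp as [_ [->|[v [Hv Hp]]]].
      * exists q. split; auto. apply descendants_refl, Hq.
      * exists v. split; auto. exact (descendants_child v p q Hp Hpq).
    + apply in_insert. destruct Hw as [->|[v [Hv Hw]]]; auto. left. eauto.
Qed.

(** All children of [u] lie in one sphere, so among the fertile ones exactly one
    has the least colour, and the ray is obtained by recursion.  Its vertices are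
    distinct because they lie in different spheres. *)
Lemma ray_of_separable : separable spheres -> has_ray V E.
Proof.
  intros [k [c [Y [Hk [Hc [HY Hinj]]]]]].
  assert (Col : forall n v, n ∈ omega -> v ∈ sphere n -> ap c v ∈ k).
  { intros n v Hn Hv. apply (ap_in c Y k); auto. apply (HY n); auto.
    rewrite ap_spheres; auto. }
  set (R := fun u v => child u v /\ fertile v /\
    forall w, child u w -> fertile w -> ap c v = ap c w \/ ap c v ∈ ap c w).
  assert (HR : definable (fun e : nat -> M => R (e 1) (e 0))) by (unfold R; definability).
  destruct (recursion (sep V fertile) a R) as [r [Hr [R0 RS]]]; auto.
  - rewrite in_sep by definability. split; [exact Ha|apply fertile_root].
  - intros u Hu. rewrite in_sep in Hu by definability. destruct Hu as [_ Hu].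
    destruct (least_ordinal k (fun m => exists v, child u v /\ fertile v /\ ap c v = m))
      as [m [Hm [[v [Hv [Fv <-]]] K]]]; auto.
    + definability.
    + destruct (fertile_child u Hu) as [v [Hv Fv]]. exists (ap c v). split; [|eauto].
      destruct Hv as [_ [n [Hn [_ Hv]]]]. apply (Col (succ n)); auto using succ_in_omega.
    + exists v. rewrite in_sep by definability. split; [split; auto; apply Fv|].
      split; [exact Hv|]. split; [exact Fv|]. intros w Hw Fw. apply K; [|eauto].
      destruct Hw as [_ [n [Hn [_ Hw]]]]. apply (Col (succ n)); auto using succ_in_omega.
  - intros u v v' _ _ _ [Hv [Fv K]] [Hv' [Fv' K']].
    assert (Eq : ap c v = ap c v').
    { destruct (K v' Hv' Fv') as [C|C]; auto. destruct (K' v Hv Fv) as [C'|C']; auto.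
      destruct (mem_asym _ _ C C'). }
    destruct Hv as [_ [n [Hn [Hu Hv]]]], Hv' as [_ [n' [Hn' [Hu' Hv']]]].
    rewrite <- (sphere_unique n n' u Hn Hn' Hu Hu') in Hv'.
    apply (Hinj (succ n)); rewrite ?ap_spheres; auto using succ_in_omega.
  - assert (Sph : forall n, n ∈ omega -> ap r n ∈ sphere n).
    { omega_induction; [definability|apply sphere_zero, R0|]. intros n Hn IH.
      destruct (RS n Hn) as [[_ [m [Hm [Hu Hv]]]] _].
      pose proof (sphere_unique n m (ap r n) Hn Hm IH Hu). subst m. exact Hv. }
    assert (HT : definable_op (fun e : nat -> M => ap r (e 0))) by definability.
    assert (InV : forall n, n ∈ omega -> ap r n ∈ V).
    { intros n Hn. specialize (Sph n Hn). apply in_sphere in Sph. tauto. }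
    exists (lam omega V (ap r)). apply is_ray_iff. split.
    + apply lam_injection; auto. intros n m Hn Hm Eq.
      apply (sphere_unique n m (ap r n)); auto. rewrite Eq. auto.
    + intros n Hn. rewrite !ap_lam; auto using succ_in_omega. apply (RS n Hn).
Qed.

End WithGraph.

Lemma separable_imp_KL : all_separable (M := M) -> KL M.
Proof.
  intros H V E HG HI HF HC. destruct (infinite_inhabited V HI) as [a Ha].
  destruct (levels_exist V E a Ha) as [L HL].
  apply (ray_of_separable V E a L); auto. apply H.
  apply (spheres_almost_acceptable V E a L); auto.
Qed.

End Koenig.

Theorem theorem5 (M : ZF) :
  (KL M <-> KL1 M) /\ (KL M <-> KL2 M) /\ (KL M <-> KL3 M) /\ (KL M <-> KL4 M) /\
  (KL M <-> KL5 M) /\ (KL M <-> KL6 M) /\ (KL M <-> KL7 M) /\ (KL M <-> KL8 M).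
Proof.
  pose proof (@KL_imp_KL1 M). pose proof (@KL_imp_KL2 M).
  pose proof (@KL_imp_KL3 M). pose proof (@KL_imp_KL4 M).
  assert (KL1 M -> KL5 M) by apply graphs_to_G. assert (KL2 M -> KL6 M) by apply graphs_to_G.
  assert (KL3 M -> KL7 M) by apply graphs_to_G. assert (KL4 M -> KL8 M) by apply graphs_to_H.
  pose proof (@separable_imp_KL M).
  pose proof (@KL5_imp_separable M). pose proof (@KL6_imp_separable M).
  pose proof (@KL7_imp_separable M). pose proof (@KL8_imp_separable M).
  tauto.
Qed.
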